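(* Let $A,B,C,D$ be real polynomials in two variables with $C(0,0)=D(0,0)=0$, and consider for $\varepsilon\ge 0$ the system $$\dot x=A(x^2,y)+\varepsilon C(x,y),\qquad \dot y=xB(x^2,y)+\varepsilon D(x,y). \qquad (S_\varepsilon)$$ Assume that there is a punctured neighborhood $\mathcal U$ of the origin in which the function $x^2B(x^2,y)-yA(x^2,y)$ does not vanish. For $\rho>0$ let $f_\rho(u)$ be the solution of the Cauchy problem $$f'=\frac{(A_{0,0}+uB_{0,0}f)f}{(1-u^2)B_{0,0}f-uA_{0,0}},\qquad f(0)=\rho,$$ where $A_{0,0}=A\big((1-u^2)f^2,uf\big)$ and $B_{0,0}=B\big((1-u^2)f^2,uf\big)$. For each $\rho>0$ such that $r=f_\rho(\sin\theta)$ is a (star-like) periodic orbit of the unperturbed system $(S_0)$, define $$N(\rho)=\int_{-1}^1 M_\rho(u)\,e^{-\int_0^u L_\rho(s)\,ds}\,du,$$ where $$L_\rho(u)=\frac{S_\rho(u)}{(1-u^2)\big(uA_{0,0}-(1-u^2)B_{0,0}f_\rho(u)\big)^2},$$ $$S_\rho(u)=(1-u^2)\big(A_{1,0}B_{0,0}-A_{0,0}B_{1,0}+2u(1-u^2)B_{0,0}^2\big)f_\rho^2(u)-4u^2(1-u^2)A_{0,0}B_{0,0}f_\rho(u)-u(1-2u^2)A_{0,0}^2,$$ $$M_\rho(u)=\frac{-f_\rho(u)\big(A_{0,0}D_0-(1-u^2)B_{0,0}C_1f_\rho(u)\big)}{(1-u^2)\big(uA_{0,0}-(1-u^2)B_{0,0}f_\rho(u)\big)^2},$$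 and the functions $A_{0,0},B_{0,0}$ are evaluated at $(f,u)=(f_\rho(u),u)$ and the functions $D_0,C_1,A_{1,0},B_{1,0}$ are evaluated at $(f,g,u)=(f_\rho(u),0,u)$. Let $\rho_0>0$ be one of these values of $\rho$. If for $\varepsilon>0$ small enough there is a continuous family $r=r(\theta,\varepsilon)$ of limit cycles of $(S_\varepsilon)$ such that $r(0,\varepsilon)\to\rho_0$ as $\varepsilon$ goes to zero, then $N(\rho_0)=0$.
   Context: Polar coordinates are $x=r\cos\theta$, $y=r\sin\theta$. A periodic orbit is star-like if $\dot\theta=(x\dot y-y\dot x)/r^2$ does not vanish on it, so that it is given by a smooth $2\pi$-periodic function $r=r(\theta)>0$; a limit cycle is a periodic orbit isolated in the set of periodic orbits. In the definition of $N(\rho)$, $r=f_\rho(\sin\theta)$ is a star-like periodic orbit of $(S_0)$, with $f_\rho$ defined on all of $[-1,1]$. Decompositions. Introduce variables $f,g,u,v$ with $v^2=1-u^2$ and put $x=(f+vg)v$, $y=(f+vg)u$. Using $v^{2k}=(1-u^2)^k$ and $v^{2k+1}=v(1-u^2)^k$, every polynomial $H(x,y)$ can be written uniquely as $$H\big((f+vg)v,(f+vg)u\big)=H_0(f,g,u)+v\,H_1(f,g,u)$$ with polynomials $H_0,H_1$. This defines $C_1$ (from $H=C$) and $D_0$ (from $H=D$). If $H(x,y)=K(x^2,y)$ with $K$ a polynomial, then $$H_0=K_{0,0}(f,u)+(1-u^2)g^2K_{0,1}(f,g,u),\qquad H_1=g\,K_{1,0}(f,g,u),$$ with polynomials $K_{0,0},K_{0,1},K_{1,0}$,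 where $K_{0,0}(f,u)=K\big((1-u^2)f^2,uf\big)$. This defines $A_{0,0},A_{1,0}$ (from $K=A$) and $B_{0,0},B_{1,0}$ (from $K=B$). *)

(* Defs.v *)
From mathcomp Require Import all_boot all_order all_algebra.
From mathcomp Require Import all_classical all_reals all_analysis.
From mathcomp Require Import ring lra.
(* The notations of [mpoly] clash with those of [all_analysis]. *)
From mathcomp Require Import -(notations) mpoly.
Set Implicit Arguments.
Unset Strict Implicit.
Unset Printing Implicit Defensive.
Import numFieldNormedType.Exports.
Import Order.TTheory GRing.Theory Num.Theory.
Local Open Scope classical_set_scope.
Local Open Scope ring_scope.

Definition eval2 (R : realType) (H : mpoly.mpoly 2 R) (x y : R) : R :=
  mpoly.meval (fun i : 'I_2 => [:: x; y]`_i) H.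

Definition eval3 (R : realType) (H : mpoly.mpoly 3 R) (f g u : R) : R :=
  mpoly.meval (fun i : 'I_3 => [:: f; g; u]`_i) H.

(* The identity [H((f + v g) v, (f + v g) u) = H0(f, g, u) + v H1(f, g, u)]
   modulo [v^2 = 1 - u^2]; the real points of the latter hypersurface are
   Zariski dense, so that evaluation determines [H0] and [H1]. *)
Definition decomposition (R : realType)
    (H : R -> R -> R) (H0 H1 : R -> R -> R -> R) : Prop :=
  forall f g u v : R, v ^+ 2 = 1 - u ^+ 2 ->
    H ((f + v * g) * v) ((f + v * g) * u) = H0 f g u + v * H1 f g u.

Definition poly_decomposition (R : realType)
    (H : mpoly.mpoly 2 R) (H0 H1 : mpoly.mpoly 3 R) : Prop :=
  decomposition (eval2 H) (eval3 H0) (eval3 H1).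

Definition eval00 (R : realType) (K : mpoly.mpoly 2 R) (f u : R) : R :=
  eval2 K ((1 - u ^+ 2) * f ^+ 2) (u * f).

(* The refined decomposition of [H(x, y) = K(x^2, y)]. *)
Definition even_poly_decomposition (R : realType)
    (K : mpoly.mpoly 2 R) (K01 K10 : mpoly.mpoly 3 R) : Prop :=
  decomposition (fun x y => eval2 K (x ^+ 2) y)
    (fun f g u => eval00 K f u + (1 - u ^+ 2) * g ^+ 2 * eval3 K01 f g u)
    (fun f g u => g * eval3 K10 f g u).

Lemma eval3D (R : realType) (p q : mpoly.mpoly 3 R) (f g u : R) :
  eval3 (p + q) f g u = eval3 p f g u + eval3 q f g u.
Proof. exact: mpoly.mevalD. Qed.

Lemma eval3B (R : realType) (p q : mpoly.mpoly 3 R) (f g u : R) :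
  eval3 (p - q) f g u = eval3 p f g u - eval3 q f g u.
Proof. exact: mpoly.mevalB. Qed.

Lemma eval3M (R : realType) (p q : mpoly.mpoly 3 R) (f g u : R) :
  eval3 (p * q) f g u = eval3 p f g u * eval3 q f g u.
Proof. exact: mpoly.mevalM. Qed.

Lemma eval3Z (R : realType) (c : R) (p : mpoly.mpoly 3 R) (f g u : R) :
  eval3 (c *: p) f g u = c * eval3 p f g u.
Proof. exact: mpoly.mevalZ. Qed.

Lemma eval3_0 (R : realType) (f g u : R) : eval3 0 f g u = 0.
Proof. exact: mpoly.meval0. Qed.

Lemma eval3_1 (R : realType) (f g u : R) : eval3 1 f g u = 1.
Proof. exact: mpoly.meval1. Qed.

Lemma poly_decomposition_exists (R : realType) (H : mpoly.mpoly 2 R) :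
  exists H0 H1, poly_decomposition H H0 H1.
Proof.
pose X (i : 'I_3) : mpoly.mpoly 3 R := mpoly.mpolyX R (mpoly.mnm1 i).
pose F := X (inord 0); pose G := X (inord 1); pose U := X (inord 2).
have eF f g u : eval3 F f g u = f by rewrite /eval3 mpoly.mevalXU inordK.
have eG f g u : eval3 G f g u = g by rewrite /eval3 mpoly.mevalXU inordK.
have eU f g u : eval3 U f g u = u by rewrite /eval3 mpoly.mevalXU inordK.
pose P (h : mpoly.mpoly 2 R) := exists H0 H1, poly_decomposition h H0 H1.
have PM p q : P p -> P q -> P (p * q).
  move=> [p0 [p1 hp]] [q0 [q1 hq]].
  exists (p0 * q0 + (1 - U * U) * p1 * q1), (p0 * q1 + p1 * q0).
  move=> f g u v hv; rewrite /eval2 mpoly.mevalM -/(eval2 _ _ _).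
  rewrite -/(eval2 q _ _) hp // hq // !(eval3B, eval3D, eval3M, eval3_1, eU).
  have -> : 1 - u * u = v ^+ 2 by rewrite hv expr2.
  by ring.
have P1 : P 1.
  exists 1, 0 => f g u v hv; rewrite eval3_1 eval3_0 /eval2 mpoly.meval1; ring.
have Px i : P (mpoly.mpolyX R (mpoly.mnm1 i)).
  case: i => [[|[|//]] hi].
    exists ((1 - U * U) * G), F => f g u v hv.
    rewrite /eval2 mpoly.mevalXU /= !(eval3M, eval3B, eval3_1, eU, eF, eG).
    have -> : 1 - u * u = v ^+ 2 by rewrite hv expr2.
    by ring.
  exists (U * F), (U * G) => f g u v hv.
  rewrite /eval2 mpoly.mevalXU /= !(eval3M, eU, eF, eG); ring.
rewrite -/(P H); elim/mpoly.mpolyind: H => [|c m p _ _ [p0 [p1 hp]]].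
  exists 0, 0 => f g u v hv; rewrite !eval3_0 /eval2 mpoly.meval0; ring.
have [m0 [m1 hm]] : P (mpoly.mpolyX R m).
  rewrite mpoly.mpolyXE_id; elim/big_rec: _ => // i q _ Pq; apply: (PM _ _ _ Pq).
  by elim: (_ m i) => [|k IH]; rewrite ?expr0 // exprS; apply: PM.
exists (c *: m0 + p0), (c *: m1 + p1) => f g u v hv.
rewrite /eval2 mpoly.mevalD mpoly.mevalZ -/(eval2 _ _ _) -/(eval2 p _ _).
by rewrite hp // hm // !(eval3D, eval3Z); ring.
Qed.

Lemma even_poly_decomposition_exists (R : realType) (K : mpoly.mpoly 2 R) :
  exists K01 K10, even_poly_decomposition K K01 K10.
Proof.
pose X (i : 'I_3) : mpoly.mpoly 3 R := mpoly.mpolyX R (mpoly.mnm1 i).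
pose F := X (inord 0); pose G := X (inord 1); pose U := X (inord 2).
have eF f g u : eval3 F f g u = f by rewrite /eval3 mpoly.mevalXU inordK.
have eG f g u : eval3 G f g u = g by rewrite /eval3 mpoly.mevalXU inordK.
have eU f g u : eval3 U f g u = u by rewrite /eval3 mpoly.mevalXU inordK.
(* [K00] is carried along as a polynomial, to be multiplied with the others. *)
pose P (h : mpoly.mpoly 2 R) := exists h00 K01 K10,
  even_poly_decomposition h K01 K10 /\
  forall f g u, eval3 h00 f g u = eval00 h f u.
have PM p q : P p -> P q -> P (p * q).
  move=> [p00 [p01 [p10 [hp ep]]]] [q00 [q01 [q10 [hq eq]]]].
  exists (p00 * q00).
  exists (p00 * q01 + p01 * q00 + (1 - U * U) * G * G * p01 * q01 + p10 * q10).
  exists (p10 * (q00 + (1 - U * U) * G * G * q01)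
          + q10 * (p00 + (1 - U * U) * G * G * p01)).
  split=> [f g u v hv|f g u]; last first.
    by rewrite eval3M ep eq /eval00 /eval2 mpoly.mevalM.
  rewrite /eval00 /eval2 !mpoly.mevalM -/(eval2 _ _ _) -/(eval2 q _ _).
  rewrite hp // hq // -!/(eval2 _ _ _) -/(eval2 q _ _).
  rewrite -/(eval00 p _ _) -/(eval00 q _ _).
  rewrite !(eval3B, eval3D, eval3M, eval3_1, eU, eG) !ep !eq.
  have -> : 1 - u * u = v ^+ 2 by rewrite hv expr2.
  by ring.
have P1 : P 1.
  exists 1, 0, 0; split=> [f g u v hv|f g u].
    by rewrite /eval00 /eval2 !mpoly.meval1 !eval3_0; ring.
  by rewrite eval3_1 /eval00 /eval2 mpoly.meval1.
have Px i : P (mpoly.mpolyX R (mpoly.mnm1 i)).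
  case: i => [[|[|//]] hi].
    exists ((1 - U * U) * F * F), (1 - U * U), ((1 + 1) * (1 - U * U) * F).
    split=> [f g u v hv|f g u]; rewrite /eval00 /eval2 !mpoly.mevalXU /=.
      rewrite !(eval3B, eval3M, eval3D, eval3_1, eU, eF).
      have -> : 1 - u * u = v ^+ 2 by rewrite hv expr2.
      by ring.
    by rewrite !(eval3B, eval3M, eval3_1, eU, eF); ring.
  exists (U * F), 0, U.
  split=> [f g u v hv|f g u]; rewrite /eval00 /eval2 !mpoly.mevalXU /=.
    by rewrite eval3_0 eU; ring.
  by rewrite eval3M eU eF.
have [h00 [K01 [K10 [hK _]]]] : P K; last by exists K01, K10.
elim/mpoly.mpolyind: K => [|c m p _ _ [p00 [p01 [p10 [hp ep]]]]].
  exists 0, 0, 0; split=> [f g u v hv|f g u].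
    by rewrite /eval00 /eval2 !mpoly.meval0 !eval3_0; ring.
  by rewrite eval3_0 /eval00 /eval2 mpoly.meval0.
have [m00 [m01 [m10 [hm em]]]] : P (mpoly.mpolyX R m).
  rewrite mpoly.mpolyXE_id; elim/big_rec: _ => // i q _ Pq; apply: (PM _ _ _ Pq).
  by elim: (_ m i) => [|k IH]; rewrite ?expr0 // exprS; apply: PM.
exists (c *: m00 + p00), (c *: m01 + p01), (c *: m10 + p10).
split=> [f g u v hv|f g u]; last first.
  by rewrite eval3D eval3Z em ep /eval00 /eval2 mpoly.mevalD mpoly.mevalZ.
rewrite /eval00 /eval2 !mpoly.mevalD !mpoly.mevalZ -!/(eval2 _ _ _).
by rewrite -!/(eval2 p _ _) hp // hm // -!/(eval00 _ _ _) !(eval3D, eval3Z); ring.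
Qed.

Definition xfield (R : realType) (A C : mpoly.mpoly 2 R) (e x y : R) : R :=
  eval2 A (x ^+ 2) y + e * eval2 C x y.

Definition yfield (R : realType) (B D : mpoly.mpoly 2 R) (e x y : R) : R :=
  x * eval2 B (x ^+ 2) y + e * eval2 D x y.

Definition periodic_orbit (R : realType) (X Y : R -> R -> R)
    (P : set (R * R)) : Prop :=
  exists (x y : R -> R) (T : R),
    [/\ (forall t : R, is_derive t 1 x (X (x t) (y t)) /\
                   is_derive t 1 y (Y (x t) (y t))),
        0 < T, periodic x T /\ periodic y T,
        (exists t, (x t, y t) != (x 0, y 0)) &
        P = range (fun t => (x t, y t))].

Definition limit_cycle (R : realType) (X Y : R -> R -> R)
    (P : set (R * R)) : Prop :=
  periodic_orbit X Y P /\
  exists V : set (R * R), [/\ open V, P `<=` V &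
    forall Q, periodic_orbit X Y Q -> Q `<=` V -> Q = P].

Definition angular_velocity (R : realType) (X Y : R -> R -> R) (x y : R) : R :=
  (x * Y x y - y * X x y) / (x ^+ 2 + y ^+ 2).

Definition polar_curve (R : realType) (r : R -> R) : set (R * R) :=
  range (fun t => (r t * cos t, r t * sin t)).

Definition smooth (R : realType) (r : R -> R) : Prop :=
  forall n (t : R), derivable (derive1n n r) t 1.

Definition starlike_periodic_orbit (R : realType) (X Y : R -> R -> R)
    (r : R -> R) : Prop :=
  [/\ smooth r, periodic r (pi *+ 2), (forall t, 0 < r t),
      periodic_orbit X Y (polar_curve r) &
      forall x y, polar_curve r (x, y) -> angular_velocity X Y x y != 0].

(* Solution on the whole of [-1, 1]; the graph has to stay in the domain of the
   right-hand side of the differential equation. *)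
Definition cauchy_solution (R : realType) (A B : mpoly.mpoly 2 R) (rho : R)
    (f : R -> R) : Prop :=
  [/\ {within `[-1, 1], continuous f}, f 0 = rho,
      (forall u : R, -1 <= u <= 1 ->
        (1 - u ^+ 2) * eval00 B (f u) u * f u - u * eval00 A (f u) u != 0) &
      forall u : R, -1 < u < 1 ->
        is_derive u 1 f
          ((eval00 A (f u) u + u * eval00 B (f u) u * f u) * f u /
           ((1 - u ^+ 2) * eval00 B (f u) u * f u - u * eval00 A (f u) u))].

Definition melnikov_S (R : realType) (A B : mpoly.mpoly 2 R)
    (A10 B10 : mpoly.mpoly 3 R) (f : R -> R) (u : R) : R :=
  let a00 := eval00 A (f u) u in
  let b00 := eval00 B (f u) u in
  let a10 := eval3 A10 (f u) 0 u in
  let b10 := eval3 B10 (f u) 0 u in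
  (1 - u ^+ 2) * (a10 * b00 - a00 * b10 + 2 * u * (1 - u ^+ 2) * b00 ^+ 2)
    * f u ^+ 2
  - 4 * u ^+ 2 * (1 - u ^+ 2) * a00 * b00 * f u
  - u * (1 - 2 * u ^+ 2) * a00 ^+ 2.

Definition melnikov_L (R : realType) (A B : mpoly.mpoly 2 R)
    (A10 B10 : mpoly.mpoly 3 R) (f : R -> R) (u : R) : R :=
  let a00 := eval00 A (f u) u in
  let b00 := eval00 B (f u) u in
  melnikov_S A B A10 B10 f u /
    ((1 - u ^+ 2) * (u * a00 - (1 - u ^+ 2) * b00 * f u) ^+ 2).

Definition melnikov_M (R : realType) (A B : mpoly.mpoly 2 R)
    (C1 D0 : mpoly.mpoly 3 R) (f : R -> R) (u : R) : R :=
  let a00 := eval00 A (f u) u in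
  let b00 := eval00 B (f u) u in
  let c1 := eval3 C1 (f u) 0 u in
  let d0 := eval3 D0 (f u) 0 u in
  - f u * (a00 * d0 - (1 - u ^+ 2) * b00 * c1 * f u) /
    ((1 - u ^+ 2) * (u * a00 - (1 - u ^+ 2) * b00 * f u) ^+ 2).

Definition oriented_integral (R : realType) (a b : R) (h : R -> R) : R :=
  if a <= b then \int[lebesgue_measure]_(s in `[a, b]) h s
  else - \int[lebesgue_measure]_(s in `[b, a]) h s.

(* The integrand is undefined at -1 and 1, hence the open interval. The
   integral is valued in the extended reals, where [+oo - oo] is [-oo], so that
   its vanishing entails its absolute convergence. *)
Definition melnikov (R : realType) (A B : mpoly.mpoly 2 R)
    (A10 B10 C1 D0 : mpoly.mpoly 3 R) (f : R -> R) : \bar R :=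
  (\int[lebesgue_measure]_(u in `](-1)%R, 1%R[)
    (melnikov_M A B C1 D0 f u *
     expR (- oriented_integral 0 u (melnikov_L A B A10 B10 f)))%:E)%E.

(* Main.v *)
Require Import Defs.
From mathcomp Require Import all_boot all_order all_algebra.
From mathcomp Require Import all_classical all_reals all_analysis.
From mathcomp Require Import measurable_realfun ring lra.
From mathcomp Require Import -(notations) mpoly.
Import numFieldNormedType.Exports.
Import Order.TTheory GRing.Theory Num.Theory.
Local Open Scope classical_set_scope.
Local Open Scope ring_scope.

(** Why the theorem holds. In polar coordinates the system reads
    [dr/dt = slope (cos t) (sin t) r e], where [t] is the angle. The unperturbed
    system is invariant under the reflection of [t] into [pi - t] combined with
    the reversal of time, and so is its orbit [r0 t = f (sin t)]. For the
    perturbed orbit [r t e] consider the antisymmetric part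
    [delta t = r t e - r (pi - t) e], which vanishes at [- (pi / 2)] (by
    periodicity) and at [pi / 2]. Subtracting the two differential equations and
    using the symmetry of the unperturbed one gives exactly
    [delta' = Le * delta + e * me], where [Le] is a divided difference of the
    unperturbed slope between the two radii and [me] is the first order effect of
    the perturbation, added up over [t] and [pi - t] ([slope_expansion]).

    When [e] tends to [0] the orbit [r t e] tends to [r0 t] uniformly
    ([uniform_persistence]), so that [Le] and [me] tend uniformly to the radial
    derivative [Lam] of the unperturbed slope and to a function [m]. Dividing by
    [e] and multiplying by the integrating factor [E] of [Lam] shows that the
    integral of [E * m] from [- (pi / 2)] to [pi / 2] is zero
    ([first_order_condition]). Only continuity of the divided differences is
    used; no derivative of the flow with respect to the parameter appears, and
    the two uses of Gronwall's inequality ([gronwall_bound]) replace it.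

    It remains to recognize this integral. With [u = sin t] and [v = cos t],
    [Lam = v * L - u / v] ([melnikov_LE]) and [m = 2 * v ^+ 2 * M]
    ([melnikov_ME]), so that [E * v] is the exponential of minus the primitive of
    [L], and the integral of [E * m] over the angle is twice the integral
    defining [N] ([integral_arcsine_substitution]). The integrand in [u] is
    singular at [-1] and [1], but only like the derivative of the arcsine, hence
    it is absolutely integrable. *)

Set Implicit Arguments.
Unset Strict Implicit.
Unset Printing Implicit Defensive.

(** * The polar equation of a star-like periodic orbit *)

Section polar.
Variable R : realType.
Implicit Types (r : R -> R) (X Y : R -> R -> R).

Lemma periodicz r (T : R) (k : int) t : periodic r T -> r (t + T *~ k) = r t.
Proof.
move=> rT; case: k => n; first exact: (periodicn rT).
by rewrite NegzE mulrNz -[LHS](periodicn rT n.+1) pmulrn subrK.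
Qed.

(** What holds on one period holds everywhere; a single representative has to
    serve several periodic functions at once, hence the quantifier inside. *)
Lemma angle_reduction (t : R) : exists2 t', t' \in `[0, pi *+ 2] &
  forall f : R -> R, periodic f (pi *+ 2) -> f t = f t'.
Proof.
have pi2 : 0 < pi *+ 2 :> R by rewrite pmulrn_lgt0 ?pi_gt0.
pose k := Num.floor (t / (pi *+ 2)).
exists (t - (pi *+ 2) *~ k); last by move=> f fT; rewrite -mulrNz periodicz.
have := floor_itv (t / (pi *+ 2)).
rewrite -/k ler_pdivlMr// ltr_pdivrMr// intrD mulrDl mul1r mulrzl in_itv/=.
by move=> /andP[? ?]; apply/andP; split; lra.
Qed.

Lemma cos_eq1 (t : R) : cos t = 1 -> exists k : int, t = (pi *+ 2) *~ k.
Proof.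
have pi2 : 0 < pi *+ 2 :> R by rewrite pmulrn_lgt0 ?pi_gt0.
(* the representative of [t] modulo [2 pi] in the interval [-pi, pi[ *)
pose k := Num.floor ((t + pi) / (pi *+ 2)).
move=> t1; exists k; apply/eqP; rewrite -subr_eq0 -normr_eq0; apply/eqP.
have tk : - pi <= t - pi *+ 2 *~ k < pi.
  have := floor_itv ((t + pi) / (pi *+ 2)).
  rewrite -/k ler_pdivlMr// ltr_pdivrMr// intrD mulrDl mul1r mulrzl.
  by move=> /andP[? ?]; apply/andP; split; lra.
apply: cos_inj; rewrite ?in_itv/= ?lexx ?pi_ge0 ?normr_ge0//=.
  by rewrite ler_norml; case/andP: tk => -> /ltW.
rewrite cos_norm cos0 -mulrNz.
by rewrite (@periodicz (@cos R) _ _ _ (@cosD2pi R)).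
Qed.

Lemma cos_piB (t : R) : cos (pi - t) = - cos t.
Proof. by rewrite cosB cospi sinpi mul0r addr0 mulN1r. Qed.

Lemma sin_piB (t : R) : sin (pi - t) = sin t.
Proof. by rewrite sinB cospi sinpi mul0r add0r mulN1r opprK. Qed.

Lemma periodic_polar_angle r s t : periodic r (pi *+ 2) ->
  cos (s - t) = 1 -> r s = r t.
Proof.
move=> rT /cos_eq1[k stk].
by rewrite -(periodicz k t rT) -stk addrC subrK.
Qed.

(** The orbit is given with its own time, not with the polar angle. Near a time
    [t0] at which it passes through the angle [th], the angle is recovered as
    [psi t = th + atan (b t / a t)], where [a] and [b] are the coordinates in
    the frame rotated by [th]. The radius at that angle is the distance to the
    origin, since [r] is [2 pi]-periodic and two polar angles of one point differ
    by a multiple of [2 pi]; the chain rule applied to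
    [r (psi t) ^+ 2 = a t ^+ 2 + b t ^+ 2] at [t0] is the polar equation, free
    of denominators. *)
Lemma starlike_polar_ode X Y r (th : R) : starlike_periodic_orbit X Y r ->
  is_derive th 1 r (derive1 r th) /\
  let x := r th * cos th in let y := r th * sin th in
  derive1 r th * (cos th * Y x y - sin th * X x y) =
  r th * (cos th * X x y + sin th * Y x y).
Proof.
move=> [rsm rT rpos [x [y [T [xyd _ _ _ PE]]]] _].
have dr : is_derive th 1 r (derive1 r th).
  by rewrite derive1E; apply: derivableP; exact: (rsm 0).
split=> //=.
have [t0 _ [xt0 yt0]] : range (fun t => (x t, y t)) (r th * cos th, r th * sin th).
  by rewrite -PE; exists th.
set c := cos th; set s := sin th.
have cs1 : c ^+ 2 + s ^+ 2 = 1 by exact: cos2Dsin2.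
have [dx dy] := xyd t0.
rewrite xt0 yt0 -/c -/s in dx dy.
set Xp := X _ _ in dx *; set Yp := Y _ _ in dy *.
pose a t := x t * c + y t * s.
pose b t := y t * c - x t * s.
have da : is_derive t0 1 a (Xp * c + Yp * s).
  rewrite /a; apply: is_derive_eq.
  by rewrite /GRing.scale/= !mulr0 !add0r; ring.
have db : is_derive t0 1 b (Yp * c - Xp * s).
  rewrite /b; apply: is_derive_eq.
  by rewrite /GRing.scale/= !mulr0 !add0r; ring.
have at0 : a t0 = r th.
  by rewrite /a xt0 yt0 -/c -/s -[RHS]mulr1 -cs1; ring.
have bt0 : b t0 = 0 by rewrite /b xt0 yt0 -/c -/s; ring.
pose psi t := th + atan (b t * (a t)^-1).
have psit0 : psi t0 = th by rewrite /psi bt0 mul0r atan0 addr0.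
have a0 : a t0 != 0 by rewrite at0 gt_eqF.
have dpsi : is_derive t0 1 psi ((Yp * c - Xp * s) / r th).
  rewrite /psi.
  have dV := is_deriveV a0 da.
  have dq : is_derive t0 1 (fun t => b t * (a t)^-1) ((Yp * c - Xp * s) / r th).
    apply: is_derive_eq.
    by rewrite /GRing.scale/= bt0 at0 mul0r add0r mulrC.
  have dat : is_derive t0 1 (atan \o (fun t => b t * (a t)^-1))
     ((Yp * c - Xp * s) / r th).
    apply: is_derive_eq.
    by rewrite bt0 mul0r expr0n/= addr0 invr1 mul1r.
  apply: is_derive_eq.
  by rewrite add0r mul1r.
have near_eq : \forall t \near t0, (r \o psi) t ^+ 2 = a t ^+ 2 + b t ^+ 2.
  have ca : {for t0, continuous a}.
    by apply/differentiable_continuous/derivable1_diffP; case: da.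
  near=> t.
  have at_gt0 : 0 < a t.
    near: t; move/cvgr_gt: ca; apply.
    by rewrite at0.
  have [phi _ [xt yt]] : polar_curve r (x t, y t) by rewrite PE; exists t.
  have aE : a t = r phi * cos (phi - th).
    by rewrite /a -xt -yt cosB -/c -/s; ring.
  have bE : b t = r phi * sin (phi - th).
    by rewrite /b -xt -yt sinB -/c -/s; ring.
  have abE : a t ^+ 2 + b t ^+ 2 = r phi ^+ 2.
    by rewrite aE bE -[RHS]mulr1 -(cos2Dsin2 (phi - th)); ring.
  (* both angles represent the point at time [t]: the cosine of their
     difference is [1] *)
  rewrite abE /=; congr (_ ^+ 2); symmetry.
  apply: periodic_polar_angle => //.
  set q := b t / a t.
  have -> : phi - psi t = (phi - th) - atan q by rewrite /psi /q; ring.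
  have rp := rpos phi.
  have cosE : cos (atan q) = a t / r phi.
    rewrite cos_atan -[RHS]invrK invf_div; congr (_^-1).
    rewrite -[RHS]ger0_norm ?divr_ge0 ?ltW// -sqrtr_sqr.
    congr (Num.sqrt _).
    have -> : (r phi / a t) ^+ 2 = (a t ^+ 2 + b t ^+ 2) / a t ^+ 2.
      by rewrite abE expr_div_n.
    rewrite /q.
    by field; rewrite gt_eqF.
  have cq0 : cos (atan q) != 0 by rewrite cosE gt_eqF// divr_gt0.
  have sinE : sin (atan q) = q * cos (atan q).
    by have := congr1 (fun z => z * cos (atan q)) (atanK q); rewrite /tan divfK.
  rewrite cosB sinE cosE.
  have -> : cos (phi - th) = a t / r phi by rewrite aE; field; rewrite gt_eqF.
  have -> : sin (phi - th) = b t / r phi by rewrite bE; field; rewrite gt_eqF.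
  have -> : 1 = (a t ^+ 2 + b t ^+ 2) / r phi ^+ 2.
    by rewrite abE divff// expf_neq0// gt_eqF.
  by rewrite /q; field; rewrite !gt_eqF.
rewrite -psit0 in dr.
have d1 := @is_derive1_comp _ r psi t0 _ _ dr dpsi.
have e1 : is_derive t0 1 (fun t => (r \o psi) t ^+ 2)
    (2 * r th * (derive1 r th * ((Yp * c - Xp * s) / r th))).
  apply: is_derive_eq.
  by rewrite /= psit0 /GRing.scale/=; ring.
have e2 : is_derive t0 1 (fun t => a t ^+ 2 + b t ^+ 2)
    (2 * r th * (Xp * c + Yp * s)).
  apply: is_derive_eq.
  by rewrite /= bt0 at0 /GRing.scale/=; ring.
have e3 := near_eq_is_derive near_eq e1.
have := etrans (esym (@derive_val _ _ _ _ _ _ _ e3)) (@derive_val _ _ _ _ _ _ _ e2).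
have rp := rpos th.
move=> eq1.
have r0 : r th != 0 by rewrite gt_eqF.
apply: (mulfI (_ : 2 * r th != 0)); first by rewrite mulf_neq0 ?pnatr_eq0.
have -> : 2 * r th * (r th * (c * Xp + s * Yp)) =
  r th * (2 * r th * (Xp * c + Yp * s)) by ring.
by rewrite -eq1; field.
Unshelve. all: by end_near. Qed.

End polar.

(** * Gronwall's inequality *)

Section gronwall.
Variable R : realType.

(** The differential inequality is only known while [d] stays below [eta]. The
    weight [e ^+ 2] absorbs the inhomogeneous term, as [2 * `|d| * e] is at most
    [d ^+ 2 + e ^+ 2]: up to the first time at which [`|d|] reaches [eta], the
    energy [(d ^+ 2 + e ^+ 2) * expR (- 3 * K * t)] does not increase, so that
    the bound on the initial value excludes such a time. *)
Lemma gronwall_bound (d d' : R -> R) (a b K e eta : R) : a <= b -> 0 <= K ->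
  (forall t, t \in `[a, b] -> is_derive t 1 d (d' t)) ->
  (forall t, t \in `[a, b] -> `|d t| < eta -> `|d' t| <= K * (`|d t| + e)) ->
  (d a ^+ 2 + e ^+ 2) * expR (3 * K * (b - a)) < eta ^+ 2 -> 0 < eta ->
  forall t, t \in `[a, b] -> `|d t| < eta.
Proof.
move=> ab K0 dd dK small eta0.
have dcont : {within `[a, b], continuous d}.
  by apply: derivable_within_continuous => t tab; case: (dd t tab).
pose W t := (d t ^+ 2 + e ^+ 2) * expR (- (3 * K) * t).
have Wle s : s \in `[a, b] -> (forall t, t \in `[a, s[ -> `|d t| < eta) -> `|d s| < eta.
  rewrite in_itv/= => /andP[as_ sb] slt.
  have sub t : t \in `[a, s] -> t \in `[a, b].
    by rewrite !in_itv/= => /andP[-> ts]; rewrite (le_trans ts).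
  have dW t : t \in `[a, b] -> is_derive t 1 W
      ((2 * d t * d' t - 3 * K * (d t ^+ 2 + e ^+ 2)) * expR (- (3 * K) * t)).
    move=> tab; have ddt := dd t tab.
    have dex : is_derive t 1 (expR \o (fun t => - (3 * K) * t))
        (expR (- (3 * K) * t) * (- (3 * K))).
      apply: is_derive1_comp.
      by apply: is_derive_eq; rewrite /GRing.scale/=; ring.
    rewrite /W; apply: is_derive_eq.
    by rewrite /= /GRing.scale/=; ring.
  have Wa : W s <= W a.
    apply: (@ler0_derive1_le_cc _ W a s); rewrite ?in_itv/= ?lexx ?as_//.
    - move=> t /subset_itv_oo_cc tas; by case: (dW t (sub t tas)).
    - move=> t tas; have tab := sub t (subset_itv_oo_cc tas).
      rewrite derive1E (@derive_val _ _ _ _ _ _ _ (dW t tab)).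
      rewrite pmulr_lle0 ?expR_gt0// subr_le0.
      have dlt : `|d t| < eta.
        by apply: slt; move: tas; rewrite !in_itv/= => /andP[/ltW -> ->].
      have h1 : d t * d' t <= `|d t| * (K * (`|d t| + e)).
        by rewrite (le_trans (ler_norm _))// normrM ler_wpM2l// dK.
      have h2 : `|d t| * e *+ 2 <= `|d t| ^+ 2 + e ^+ 2.
        by rewrite -subr_ge0 (_ : _ - _ = (`|d t| - e) ^+ 2) ?sqr_ge0//; ring.
      have -> : d t ^+ 2 = `|d t| ^+ 2 by rewrite real_normK ?num_real.
      have h3 : 0 <= K * e ^+ 2 by rewrite mulr_ge0// sqr_ge0.
      have h4 := ler_wpM2l K0 h2.
      move: h1 h4 h3; set z := `|d t|; set w := d t * d' t => h1 h4 h3.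
      have -> : 2 * d t * d' t = 2 * w by rewrite /w; ring.
      have : 2 * w <= 2 * (z * (K * (z + e))) by rewrite ler_pM2l.
      move/le_trans; apply.
      have -> : 2 * (z * (K * (z + e))) = 2 * (K * z ^+ 2) + K * (z * e *+ 2) by ring.
      rewrite -subr_ge0; rewrite -subr_ge0 in h4.
      have -> : 3 * K * (z ^+ 2 + e ^+ 2) - (2 * (K * z ^+ 2) + K * (z * e *+ 2)) =
        (K * (z ^+ 2 + e ^+ 2) - K * (z * e *+ 2)) + 2 * (K * e ^+ 2) by ring.
      by rewrite addr_ge0// mulr_ge0.
    - apply: derivable_within_continuous => t tas.
      by case: (dW t (sub t tas)).
  have : d s ^+ 2 < eta ^+ 2.
    apply: le_lt_trans small.
    apply: (@le_trans _ _ (W s * expR (3 * K * s))).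
      rewrite /W -[leRHS]mulrA -expRD mulNr addNr expR0 mulr1 lerDl; exact: sqr_ge0.
    rewrite (le_trans (ler_wpM2r (expR_ge0 _) Wa))// /W -[leLHS]mulrA -expRD.
    rewrite ler_wpM2l ?addr_ge0 ?sqr_ge0// ler_expR.
    rewrite mulNr addrC -mulrBr ler_wpM2l ?mulr_ge0//.
    by rewrite lerB.
  by rewrite -[d s ^+ 2]real_normK ?num_real// ltr_pXn2r ?nnegrE// ltW.
move=> t tab; rewrite ltNge; apply/negP => dt.
(* [inf bad] is the first time at which [`|d|] reaches [eta], if there is one *)
pose bad := [set s | s \in `[a, b] /\ eta <= `|d s|].
have bad0 : bad !=set0 by exists t.
have badlb : has_lbound bad by exists a => s [] /=; rewrite in_itv/= => /andP[].
have inf_ab : inf bad \in `[a, b].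
  rewrite in_itv/= lb_le_inf//=; last first.
    by move=> s [] /=; rewrite in_itv/= => /andP[].
  by rewrite (le_trans (ge_inf badlb _) (_ : t <= b))//; move: tab; rewrite in_itv/= => /andP[].
have inf_before s : s \in `[a, inf bad[ -> `|d s| < eta.
  rewrite in_itv/= => /andP[as_ si]; rewrite ltNge; apply/negP => ds.
  have : bad s.
    split=> //; rewrite in_itv/= as_/= ltW// (lt_le_trans si)//.
    by move: inf_ab; rewrite in_itv/= => /andP[].
  by move=> /(ge_inf badlb); rewrite leNgt si.
have dinf : `|d (inf bad)| < eta by exact: Wle.
have : \forall t \near inf bad, `|d t| < eta.
  have cd : {for inf bad, continuous d}.
    by apply/differentiable_continuous/derivable1_diffP; case: (dd _ inf_ab).
  have : (fun t => `|d t|) @ inf bad --> `|d (inf bad)| by apply: cvg_norm.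
  by move/cvgr_lt; apply.
move=> /nbhs_ballP[z /= z0 zd].
have [s bs sz] := inf_adherent z0 (conj bad0 badlb).
have := bs.2; apply/negP; rewrite -ltNge; apply: zd.
by rewrite /ball/= ler0_norm ?subr_le0 ?ge_inf// opprB ltrBlDl.
Qed.
End gronwall.

(** * Polynomials along rays *)

Section polynomials.
Variable R : realType.

Lemma mpoly_alg_ind n (P : mpoly.mpoly n R -> Prop) :
  (forall c, P (mpoly.mpolyC n c)) ->
  (forall i, P (mpoly.mpolyX R (mpoly.mnm1 i))) ->
  (forall p q, P p -> P q -> P (p + q)) ->
  (forall p q, P p -> P q -> P (p * q)) ->
  forall p, P p.
Proof.
move=> PC PX PD PM; elim/mpoly.mpolyind => [|c m p _ _ Pp].
  by rewrite -(mpoly.mpolyC0 n R).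
apply: PD => //; rewrite -mpoly.mul_mpolyC; apply: (PM) => //.
rewrite mpoly.mpolyXE_id; apply: (big_rec P) => [|i q _ Pq].
  by rewrite -(mpoly.mpolyC1 n R).
apply: (PM) => //; elim: (m i) => [|k IH]; last by rewrite exprS; apply: (PM).
by rewrite expr0 -(mpoly.mpolyC1 n R).
Qed.

Lemma cvg_meval n (T : Type) (F : set_system T) (v : T -> 'I_n -> R)
    (w : 'I_n -> R) (p : mpoly.mpoly n R) : Filter F ->
  (forall i, v t i @[t --> F] --> w i) ->
  mpoly.meval (v t) p @[t --> F] --> mpoly.meval w p.
Proof.
move=> FF vw; elim/mpoly_alg_ind: p => [c|i|p q pc qc|p q pc qc].
- by under eq_fun do rewrite mpoly.mevalC; rewrite mpoly.mevalC; exact: cvg_cst.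
- by under eq_fun do rewrite mpoly.mevalXU; rewrite mpoly.mevalXU; exact: vw.
- by under eq_fun do rewrite mpoly.mevalD; rewrite mpoly.mevalD; exact: cvgD.
- by under eq_fun do rewrite mpoly.mevalM; rewrite mpoly.mevalM; exact: cvgM.
Qed.

Lemma cvg_eval2 (T : Type) (F : set_system T) (a b : T -> R) (a0 b0 : R)
    (p : mpoly.mpoly 2 R) : Filter F -> a t @[t --> F] --> a0 ->
  b t @[t --> F] --> b0 -> eval2 p (a t) (b t) @[t --> F] --> eval2 p a0 b0.
Proof. by move=> FF ca cb; apply: cvg_meval => -[[|[|//]] ?]. Qed.

Lemma cvg_eval3 (T : Type) (F : set_system T) (a b c : T -> R) (a0 b0 c0 : R)
    (p : mpoly.mpoly 3 R) : Filter F -> a t @[t --> F] --> a0 ->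
  b t @[t --> F] --> b0 -> c t @[t --> F] --> c0 ->
  eval3 p (a t) (b t) (c t) @[t --> F] --> eval3 p a0 b0 c0.
Proof. by move=> FF ca cb cc; apply: cvg_meval => -[[|[|[|//]]] ?]. Qed.

Definition radial (K : mpoly.mpoly 2 R) (v u r : R) := eval2 K ((r * v) ^+ 2) (r * u).

(** [dK] is the divided difference of [radial K v u] in the radius, with the
    division carried out; continuity is stated along filters, the form in which
    it is used. Its values at [r = s] are radial derivatives. *)
Definition radial_quotient (K : mpoly.mpoly 2 R) (dK : R -> R -> R -> R -> R) :=
  (forall v u r s, radial K v u r - radial K v u s = (r - s) * dK v u r s) /\
  forall (T : Type) (F : set_system T) (v u r s : T -> R) (v0 u0 r0 s0 : R),
    Filter F -> v t @[t --> F] --> v0 -> u t @[t --> F] --> u0 ->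
    r t @[t --> F] --> r0 -> s t @[t --> F] --> s0 ->
    dK (v t) (u t) (r t) (s t) @[t --> F] --> dK v0 u0 r0 s0.

Lemma cvg_radial (K : mpoly.mpoly 2 R) (T : Type) (F : set_system T)
    (v u r : T -> R) (v0 u0 r0 : R) : Filter F ->
  v t @[t --> F] --> v0 -> u t @[t --> F] --> u0 -> r t @[t --> F] --> r0 ->
  radial K (v t) (u t) (r t) @[t --> F] --> radial K v0 u0 r0.
Proof.
move=> FF cv cu cr; apply: cvg_eval2; last exact: cvgM.
by under eq_fun do rewrite expr2; rewrite expr2; apply: cvgM; exact: cvgM.
Qed.

Lemma radial_quotient_exists K : exists dK, radial_quotient K dK.
Proof.
elim/mpoly_alg_ind: K => [c|i|p q|p q].
- exists (fun _ _ _ _ => 0); split=> [v u r s|*]; last exact: cvg_cst.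
  by rewrite /radial /eval2 !mpoly.mevalC; ring.
- case: i => [[|[|//]] hi].
    exists (fun v _ r s => (r + s) * (v * v)); split=> [v u r s|*].
      by rewrite /radial /eval2 !mpoly.mevalXU /=; ring.
    by apply: cvgM; [exact: cvgD|exact: cvgM].
  exists (fun _ u _ _ => u); split=> // v u r s.
  by rewrite /radial /eval2 !mpoly.mevalXU /=; ring.
- move=> [dp [pE pc]] [dq [qE qc]].
  exists (fun v u r s => dp v u r s + dq v u r s); split=> [v u r s|*].
    rewrite mulrDr -pE -qE /radial /eval2 !mpoly.mevalD; ring.
  by apply: cvgD; [exact: pc|exact: qc].
- move=> [dp [pE pc]] [dq [qE qc]].
  exists (fun v u r s => dp v u r s * radial q v u r + radial p v u s * dq v u r s).
  split=> [v u r s|*]; last first.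
    by apply: cvgD; apply: cvgM; do ?[exact: pc|exact: qc|exact: cvg_radial].
  rewrite mulrDr mulrA -pE mulrCA -qE /radial /eval2 !mpoly.mevalM; ring.
Qed.

(** Evaluate the decomposition at [f + v * g] and at [f] and divide the
    difference by [v * g], which is the difference of the radii; the quotient is
    [v * g * K01 + K10], and letting [g] tend to [0] leaves [K10]. *)
Lemma radial_quotient_diag K K01 K10 dK u v f : even_poly_decomposition K K01 K10 ->
  radial_quotient K dK -> v ^+ 2 = 1 - u ^+ 2 -> v != 0 ->
  dK v u f f = eval3 K10 f 0 u.
Proof.
move=> KE [dE dc] vu v0.
have g0 : (g : R) @[g --> 0^'] --> (0 : R) by apply: cvg_within.
have cvg_g : v * g @[g --> 0^'] --> v * 0 by apply: cvgM => //; exact: cvg_cst.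
have c1 : dK v u (f + v * g) f @[g --> 0^'] --> dK v u (f + v * 0) f.
  by apply: dc; do ?exact: cvg_cst; apply: cvgD => //; exact: cvg_cst.
have c2 : v * g * eval3 K01 f g u + eval3 K10 f g u @[g --> 0^'] -->
    v * 0 * eval3 K01 f 0 u + eval3 K10 f 0 u.
  by apply: cvgD; first apply: cvgM => //; apply: cvg_eval3 => //; exact: cvg_cst.
have -> : dK v u f f = dK v u (f + v * 0) f by rewrite mulr0 addr0.
have -> : eval3 K10 f 0 u = v * 0 * eval3 K01 f 0 u + eval3 K10 f 0 u.
  by rewrite mulr0 mul0r add0r.
have c3 : dK v u (f + v * g) f @[g --> 0^'] -->
    v * 0 * eval3 K01 f 0 u + eval3 K10 f 0 u; last exact: cvg_unique c1 c3.
apply: cvg_trans c2; apply: near_eq_cvg; near=> g.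
have gn0 : g != 0 by near: g; exact: nbhs_dnbhs_neq.
have vg0 : v * g != 0 by rewrite mulf_neq0.
apply: (mulfI vg0).
have := dE v u (f + v * g) f; rewrite [f + _ - f]addrC addKr => <-.
have := KE f g u v vu; have := KE f 0 u v vu.
rewrite /radial expr0n/= !mulr0 !mul0r mulr0 !addr0 => -> ->.
by rewrite -vu; ring.
Unshelve. all: by end_near. Qed.

End polynomials.

(** * Improper integrals and primitives *)

Section integrals.
Variable R : realType.
Notation mu := (@lebesgue_measure R).

Lemma itv_oo_continuous_integrable (h : R -> R) (a b c d : R) :
  {in `]a, b[, continuous h} -> a < c -> d < b ->
  mu.-integrable `[c, d] (EFin \o h).
Proof.
move=> ch ac db; apply: continuous_compact_integrable; first exact: segment_compact.
apply: continuous_in_subspaceT => x /set_mem/=; rewrite in_itv/= => /andP[cx xd].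
by apply: ch; rewrite in_itv/= (lt_le_trans ac)//= (le_lt_trans xd).
Qed.

(** The integral is moved to a base point [c] below both [0] and [u], so that
    one formula covers both orientations near [u]. *)
Lemma oriented_integral_primitive (h : R -> R) (a b u : R) : a < 0 < b ->
  {in `]a, b[, continuous h} -> u \in `]a, b[ ->
  is_derive u 1 (fun x => oriented_integral 0 x h) (h u).
Proof.
move=> /andP[a0 b0] ch uab; have := uab; rewrite in_itv/= => /andP[au ub].
have [c [ac c0 cu]] : exists c, [/\ a < c, c < 0 & c < u].
  have amin : a < Num.min 0 u by rewrite lt_min a0.
  exists ((a + Num.min 0 u) / 2); split; first by rewrite midf_lt.
    by rewrite (lt_le_trans (midf_lt amin).2)// ge_min lexx.
  by rewrite (lt_le_trans (midf_lt amin).2)// ge_min lexx orbT.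
have [d /andP[ud db]] : exists d, u < d < b.
  by exists ((u + b) / 2); rewrite !midf_lt.
have hint x y : a < x -> y < b -> mu.-integrable `[x, y] (EFin \o h).
  exact: itv_oo_continuous_integrable.
pose F x := \int[mu]_(t in `[c, x]) h t.
have chasles x y : c <= x -> x <= y -> y < b ->
    F y - F x = \int[mu]_(t in `[x, y]) h t.
  move=> cx xy yb; rewrite /F Rintegral_itvB ?bnd_simp//; last exact: hint.
  apply: Rintegral_itv_obnd_cbnd.
  apply: integrableS (hint x y _ yb); rewrite ?(lt_le_trans ac)//.
  exact: subset_itv_oc_cc.
have E x : c < x -> x < b -> F x - F 0 = oriented_integral 0 x h.
  move=> cx xb; rewrite /oriented_integral; case: leP => x0.
    by rewrite chasles// ltW.
  by rewrite -chasles ?ltW// opprB.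
have [dF F'] := continuous_FTC1_closed ud (hint c d ac db) cu (ch u uab).
apply: (@near_eq_is_derive _ _ _ (fun x => F x - F 0)).
  near=> x; apply: E.
    by near: x; apply: lt_nbhsr.
  by near: x; apply: lt_nbhsl.
apply: is_derive_eq; first by apply: is_deriveB; apply: DeriveDef dF _.
by rewrite subr0 -derive1E.
Unshelve. all: by end_near. Qed.

(** The integrand may be unbounded at the endpoints; exhaust the open interval
    by segments, on which it is continuous, and pass to the limit by monotone
    convergence. *)
Lemma ge0_itv_oo_FTC2 (h H : R -> R) (a b la lb : R) : a < b ->
  (forall x, x \in `]a, b[ -> 0 <= h x) -> {in `]a, b[, continuous h} ->
  (forall x, x \in `]a, b[ -> is_derive x 1 H (h x)) ->
  H x @[x --> a^'+] --> la -> H x @[x --> b^'-] --> lb ->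
  (\int[mu]_(x in `]a, b[) (h x)%:E = (lb - la)%:E)%E.
Proof.
move=> ab h0 ch dH Ha Hb.
(* the shift in [n.+3] makes already the first segment nondegenerate *)
pose z n := (b - a) / n.+3%:R.
have z_gt0 n : 0 < z n by rewrite divr_gt0 ?subr_gt0 ?ltr0n.
have z_small n : a + z n < b - z n.
  rewrite -subr_gt0 /z.
  have -> : b - (b - a) / n.+3%:R - (a + (b - a) / n.+3%:R) = (b - a) * (1 - 2 / n.+3%:R).
    by field; rewrite paddr_eq0 ?ler0n// pnatr_eq0.
  rewrite mulr_gt0 ?subr_gt0// ltr_pdivrMr ?ltr0n// mul1r.
  by rewrite ltr_nat.
have z_cvg : z n @[n --> \oo] --> (0 : R).
  rewrite -(mulr0 (b - a)); apply: cvgM; first exact: cvg_cst.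
  have := @cvg_harmonic R; rewrite -(cvg_shiftn 2).
  by under eq_fun do rewrite addn2.
pose F n := `[a + z n, b - z n]%classic : set R.
have zE : `]a, b[%classic = \bigcup_n F n.
  rewrite eqEsubset; split=> [x|x [n _]]; rewrite /F /= !in_itv/=; last first.
    move=> /andP[h1 h2]; rewrite (lt_le_trans _ h1) ?ltrDl//=.
    by rewrite (le_lt_trans h2)// ltrBlDr ltrDl.
  move=> /andP[ax xb].
  have : \forall n \near \oo, z n < Num.min (x - a) (b - x).
    by move/cvgr_lt : z_cvg; apply; rewrite lt_min !subr_gt0 ax xb.
  move=> [N _ /(_ N (leqnn N))]; rewrite /= lt_min => /andP[h1 h2].
  exists N => //=; rewrite in_itv/=; apply/andP; split.
    by rewrite -lerBrDl ltW.
  by rewrite lerBrDr -lerBrDl ltW.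
have mh : measurable_fun `]a, b[ h.
  apply: open_continuous_measurable_fun => //.
  by move=> x /set_mem/= xab; apply: ch.
have Fsub n : F n `<=` `]a, b[ by rewrite zE; exact: bigcup_sup.
have c1 : (\int[mu]_(x in F n) (h x)%:E)%E @[n --> \oo] -->
    (\int[mu]_(x in `]a, b[) (h x)%:E)%E.
  rewrite zE; apply: ge0_nondecreasing_set_cvg_integral => //.
  - apply/nondecreasing_seqP => n; rewrite subsetEset /F.
    have zS : z n.+1 <= z n.
      by rewrite /z ler_pM2l ?subr_gt0// lef_pV2 ?posrE ?ltr0n// ler_nat.
    move=> x; rewrite /= !in_itv/= => /andP[h1 h2]; apply/andP; split.
      by rewrite (le_trans _ h1)// lerD2l.
    by rewrite (le_trans h2)// lerB.
  - by move=> n; apply: measurable_itv.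
  - by move=> n; apply/measurable_EFinP; apply: measurable_funS mh.
  - by move=> n x /Fsub xab; rewrite lee_fin h0.
have c2 : (\int[mu]_(x in F n) (h x)%:E)%E @[n --> \oo] --> (lb - la)%:E.
  have E n : (\int[mu]_(x in F n) (h x)%:E)%E = (H (b - z n) - H (a + z n))%:E.
    rewrite EFinB; apply: continuous_FTC2 => //.
    - apply: continuous_in_subspaceT => x /set_mem xF; exact/ch/(Fsub _ _ xF).
    - have cH x : x \in F n -> {for x, continuous H}.
        move=> /set_mem /Fsub xab.
        by apply/differentiable_continuous/derivable1_diffP; case: (dH x xab).
      have : {within F n, continuous H}.
        by apply: continuous_in_subspaceT => x; exact: cH.
      move/(continuous_within_itvP _ (z_small n)) => [_ cl cr].
      split => // x xF; have /Fsub xab : F n x by apply: subset_itv_oo_cc.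
      by case: (dH x xab).
    - move=> x xF; have /Fsub xab : F n x by apply: subset_itv_oo_cc.
      by rewrite derive1E (@derive_val _ _ _ _ _ _ _ (dH x xab)).
  under eq_fun do rewrite E.
  apply: cvg_EFin; first exact: nearW.
  apply: cvgB.
    move/cvg_at_leftP : Hb; apply; split=> [n|]; first by rewrite ltrBlDr ltrDl.
    by rewrite -[X in _ --> X]subr0; apply: cvgB => //; exact: cvg_cst.
  move/cvg_at_rightP : Ha; apply; split=> [n|]; first by rewrite ltrDl.
  by rewrite -[X in _ --> X]addr0; apply: cvgD => //; exact: cvg_cst.
exact: cvg_unique c1 c2.
Qed.

(** Both [h + k] and [k] are nonnegative, and their integrals are finite. *)
Lemma dominated_itv_oo_FTC2 (h H k K : R -> R) (a b la lb ka kb : R) : a < b ->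
  (forall x, x \in `]a, b[ -> `|h x| <= k x) ->
  {in `]a, b[, continuous h} -> {in `]a, b[, continuous k} ->
  (forall x, x \in `]a, b[ -> is_derive x 1 H (h x)) ->
  (forall x, x \in `]a, b[ -> is_derive x 1 K (k x)) ->
  H x @[x --> a^'+] --> la -> H x @[x --> b^'-] --> lb ->
  K x @[x --> a^'+] --> ka -> K x @[x --> b^'-] --> kb ->
  (\int[mu]_(x in `]a, b[) (h x)%:E = (lb - la)%:E)%E.
Proof.
move=> ab hk ch ck dH dK Ha Hb Ka Kb.
have k0 x : x \in `]a, b[ -> 0 <= k x by move=> /hk; exact: le_trans.
have s0 x : x \in `]a, b[ -> 0 <= h x + k x.
  by move=> /hk; rewrite ler_norml => /andP[? _]; lra.
have cs : {in `]a, b[, continuous (fun x => h x + k x)}.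
  by move=> x xab; apply: cvgD; [exact: ch|exact: ck].
have Ik := ge0_itv_oo_FTC2 ab k0 ck dK Ka Kb.
have Is : (\int[mu]_(x in `]a, b[) (h x + k x)%:E = (lb + kb - (la + ka))%:E)%E.
  apply: (@ge0_itv_oo_FTC2 _ (fun x => H x + K x)) => //.
  - by move=> x xab; apply: is_deriveD; [exact: dH|exact: dK].
  - exact: cvgD.
  - exact: cvgD.
have fint (g : R -> R) (l : R) : (forall x, x \in `]a, b[ -> 0 <= g x) ->
    {in `]a, b[, continuous g} -> (\int[mu]_(x in `]a, b[) (g x)%:E = l%:E)%E ->
    mu.-integrable `]a, b[ (EFin \o g).
  move=> g0 cg gl; apply/integrableP; split.
    apply/measurable_EFinP; apply: open_continuous_measurable_fun => //.
    by move=> x /set_mem/= xab; apply: cg.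
  under eq_integral => x xab.
    rewrite /= ger0_norm; last by apply: g0; move: xab; rewrite inE.
    over.
  by rewrite gl ltry.
transitivity (\int[mu]_(x in `]a, b[) ((h x + k x)%:E - (k x)%:E))%E.
  by apply: eq_integral => x _; rewrite -EFinB addrK.
rewrite (@integralB_EFin _ _ _ mu _ (fun x => h x + k x) k)//.
- by rewrite Is Ik -EFinB; congr EFin; ring.
- exact: fint s0 cs Is.
- exact: fint k0 ck Ik.
Qed.

End integrals.

(** * The slope in polar coordinates *)

Section polar_field.
Variable R : realType.
Variables A B C D : mpoly.mpoly 2 R.

(** At the point of radius [r] in the direction [(v, u)] = (cosine, sine), the
    polar equation of the perturbed system is
    [r' * (den0 + e * den1) = num0 + e * num1]. *)
Definition num0 (v u r : R) :=
  v * r * (radial A v u r + u * r * radial B v u r).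
Definition den0 (v u r : R) := v ^+ 2 * radial B v u r * r - u * radial A v u r.
Definition num1 (v u r : R) :=
  r * (v * eval2 C (r * v) (r * u) + u * eval2 D (r * v) (r * u)).
Definition den1 (v u r : R) :=
  v * eval2 D (r * v) (r * u) - u * eval2 C (r * v) (r * u).
Definition slope (v u r e : R) :=
  (num0 v u r + e * num1 v u r) / (den0 v u r + e * den1 v u r).
(** The quotient [(slope e - slope 0) / e], with the division carried out, so that
    it makes sense at [e = 0] too. *)
Definition slope1 (v u r e : R) :=
  (num1 v u r * den0 v u r - num0 v u r * den1 v u r) /
  (den0 v u r * (den0 v u r + e * den1 v u r)).

Lemma starlike_slope e (r : R -> R) th :
  starlike_periodic_orbit (xfield A C e) (yfield B D e) r ->
  den0 (cos th) (sin th) (r th) + e * den1 (cos th) (sin th) (r th) != 0 ->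
  is_derive th 1 r (slope (cos th) (sin th) (r th) e).
Proof.
move=> /(starlike_polar_ode th)[dr rE] d0.
suff <- : derive1 r th = slope (cos th) (sin th) (r th) e by [].
apply: (mulIf d0); rewrite /slope divfK//; move: rE.
rewrite /xfield /yfield /= /den0 /den1 /num0 /num1 /radial.
set c := cos th; set s := sin th; set z := r th.
set a := eval2 A _ _; set b := eval2 B _ _; set p := eval2 C _ _.
set q := eval2 D _ _ => rE.
transitivity (derive1 r th * (c * (z * c * b + e * q) - s * (a + e * p))); first ring.
by rewrite rE; ring.
Qed.

Lemma radialN K (v u r : R) : radial K (- v) u r = radial K v u r.
Proof. by rewrite /radial mulrN sqrrN. Qed.

(** [num0N] and [den0N] are the reversibility of the unperturbed system: its
    polar equation is invariant under the reflection of the angle [t] into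
    [pi - t], which changes the sign of the cosine. *)
Lemma num0N v u r : num0 (- v) u r = - num0 v u r.
Proof. by rewrite /num0 !radialN !mulNr. Qed.

Lemma den0N v u r : den0 (- v) u r = den0 v u r.
Proof. by rewrite /den0 !radialN sqrrN. Qed.

Variables dA dB : R -> R -> R -> R -> R.
Hypothesis dAP : radial_quotient A dA.
Hypothesis dBP : radial_quotient B dB.

(** The divided difference of [slope] at [e = 0] in the radius. *)
Definition slope_quotient (v u r s : R) :=
  (v * (radial A v u r + s * dA v u r s
        + u * ((r + s) * radial B v u r + s ^+ 2 * dB v u r s)) * den0 v u s
   - num0 v u s * (v ^+ 2 * (radial B v u r + s * dB v u r s) - u * dA v u r s)) /
  (den0 v u r * den0 v u s).

(** An exact expansion to first order, at once in the radius and in the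
    parameter. Since its coefficients are continuous, it replaces the theorem on
    the smooth dependence of solutions on parameters. *)
Lemma slope_expansion v u r s e : den0 v u r != 0 -> den0 v u s != 0 ->
  den0 v u r + e * den1 v u r != 0 ->
  slope v u r e =
  num0 v u s / den0 v u s + slope_quotient v u r s * (r - s) + e * slope1 v u r e.
Proof.
move=> r0 s0 re0; apply/eqP; rewrite -subr_eq0; apply/eqP.
have -> : slope v u r e - (num0 v u s / den0 v u s + slope_quotient v u r s * (r - s)
    + e * slope1 v u r e) =
  (num0 v u r / den0 v u r - num0 v u s / den0 v u s)
   - slope_quotient v u r s * (r - s).
  by rewrite /slope /slope1; field; rewrite r0 re0 s0.
have nE : num0 v u r = num0 v u s + (r - s) * (v * (radial A v u r + s * dA v u r s
        + u * ((r + s) * radial B v u r + s ^+ 2 * dB v u r s))).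
  have -> : num0 v u r = num0 v u s + v * ((r - s) * radial A v u r
      + s * (radial A v u r - radial A v u s)
      + u * ((r - s) * (r + s) * radial B v u r
             + s ^+ 2 * (radial B v u r - radial B v u s))).
    by rewrite /num0; ring.
  by rewrite dAP.1 dBP.1; ring.
have dE : den0 v u r = den0 v u s
  + (r - s) * (v ^+ 2 * (radial B v u r + s * dB v u r s) - u * dA v u r s).
  have -> : den0 v u r = den0 v u s + (v ^+ 2 * ((r - s) * radial B v u r
      + s * (radial B v u r - radial B v u s))
      - u * (radial A v u r - radial A v u s)).
    by rewrite /den0; ring.
  by rewrite dAP.1 dBP.1; ring.
rewrite /slope_quotient.
set n := v * _ in nE *; set d := (_ - _ * dA _ _ _ _) in dE *.
have -> : num0 v u r / den0 v u r - num0 v u s / den0 v u s =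
  ((num0 v u r - num0 v u s) * den0 v u s - num0 v u s * (den0 v u r - den0 v u s))
   / (den0 v u r * den0 v u s).
  by field; rewrite r0 s0.
have -> : num0 v u r - num0 v u s = (r - s) * n by rewrite nE addrC addKr.
have -> : den0 v u r - den0 v u s = (r - s) * d by rewrite [X in X - _]dE addrC addKr.
by field; rewrite r0 s0.
Qed.

Section limits.
Variables (T : Type) (F : set_system T) (FF : Filter F).

Lemma cvg_sqr (f : T -> R) (l : R) :
  f t @[t --> F] --> l -> f t ^+ 2 @[t --> F] --> l ^+ 2.
Proof. by move=> fl; under eq_fun do rewrite expr2; rewrite expr2; exact: cvgM. Qed.

Variables (v u r s e : T -> R) (v0 u0 r0 s0 e0 : R).
Hypotheses (cv : v t @[t --> F] --> v0) (cu : u t @[t --> F] --> u0).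
Hypotheses (cr : r t @[t --> F] --> r0) (cs : s t @[t --> F] --> s0).
Hypotheses (ce : e t @[t --> F] --> e0).

Lemma cvg_num0 : num0 (v t) (u t) (r t) @[t --> F] --> num0 v0 u0 r0.
Proof.
by apply: cvgM; [exact: cvgM|apply: cvgD; [|apply: cvgM; [exact: cvgM|]];
  exact: cvg_radial].
Qed.

Lemma cvg_den0 : den0 (v t) (u t) (r t) @[t --> F] --> den0 v0 u0 r0.
Proof.
apply: cvgB; last by apply: cvgM => //; exact: cvg_radial.
by apply: cvgM => //; apply: cvgM; [exact: cvg_sqr|exact: cvg_radial].
Qed.

Lemma cvg_cartesian K :
  eval2 K (r t * v t) (r t * u t) @[t --> F] --> eval2 K (r0 * v0) (r0 * u0).
Proof. by apply: cvg_eval2; exact: cvgM. Qed.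

Lemma cvg_num1 : num1 (v t) (u t) (r t) @[t --> F] --> num1 v0 u0 r0.
Proof.
by apply: cvgM => //; apply: cvgD; apply: cvgM => //; exact: cvg_cartesian.
Qed.

Lemma cvg_den1 : den1 (v t) (u t) (r t) @[t --> F] --> den1 v0 u0 r0.
Proof. by apply: cvgB; apply: cvgM => //; exact: cvg_cartesian. Qed.

Lemma cvg_den : den0 (v t) (u t) (r t) + e t * den1 (v t) (u t) (r t)
  @[t --> F] --> den0 v0 u0 r0 + e0 * den1 v0 u0 r0.
Proof.
by apply: cvgD; [exact: cvg_den0|apply: cvgM => //; exact: cvg_den1].
Qed.

Lemma cvg_slope1 : den0 v0 u0 r0 != 0 ->
  den0 v0 u0 r0 + e0 * den1 v0 u0 r0 != 0 ->
  slope1 (v t) (u t) (r t) (e t) @[t --> F] --> slope1 v0 u0 r0 e0.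
Proof.
move=> d0 de0; apply: cvgM.
  by apply: cvgB; apply: cvgM; do ?[exact: cvg_num0|exact: cvg_den0|
    exact: cvg_num1|exact: cvg_den1].
apply: cvgV; first by rewrite mulf_neq0.
by apply: cvgM; [exact: cvg_den0|exact: cvg_den].
Qed.

End limits.

Lemma cvg_slope_quotient (T : Type) (F : set_system T) (v u r s : T -> R)
    (v0 u0 r0 s0 : R) : Filter F ->
  v t @[t --> F] --> v0 -> u t @[t --> F] --> u0 ->
  r t @[t --> F] --> r0 -> s t @[t --> F] --> s0 ->
  den0 v0 u0 r0 != 0 -> den0 v0 u0 s0 != 0 ->
  slope_quotient (v t) (u t) (r t) (s t) @[t --> F] -->
  slope_quotient v0 u0 r0 s0.
Proof.
move=> FF cv cu cr cs dr0 ds0.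
have cA := dAP.2 _ _ _ _ _ _ _ _ _ _ FF cv cu cr cs.
have cB := dBP.2 _ _ _ _ _ _ _ _ _ _ FF cv cu cr cs.
have rA := cvg_radial (K := A) FF cv cu cr.
have rB := cvg_radial (K := B) FF cv cu cr.
apply: cvgM; last first.
  apply: cvgV; first by rewrite mulf_neq0.
  by apply: cvgM; exact: cvg_den0.
apply: cvgB; apply: cvgM; do ?[exact: cvg_den0|exact: cvg_num0].
  apply: cvgM => //; apply: cvgD; first by apply: cvgD => //; exact: cvgM.
  apply: cvgM => //; apply: cvgD; first by apply: cvgM => //; exact: cvgD.
  by apply: cvgM => //; exact: cvg_sqr.
apply: cvgB; last exact: cvgM.
apply: cvgM; first exact: cvg_sqr.
by apply: cvgD => //; exact: cvgM.
Qed.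

End polar_field.

(** * First order averaging along the unperturbed orbit *)

Section uniformity.
Variable R : realType.

(** Compactness of the segment, as near covering: an eventual property that is
    locally uniform is uniform. *)
Lemma near_itv_uniform (I : Type) (F : set_system I) (P : R -> I -> Prop) (a b : R) :
  Filter F ->
  (forall t0, t0 \in `[a, b] -> \forall p \near filter_prod (nbhs t0) F, P p.1 p.2) ->
  \forall i \near F, forall t, t \in `[a, b] -> P t i.
Proof.
move=> FF nP.
have /compact_near_coveringP/(_ I F (fun i t => P t i) FF) := @segment_compact R a b.
apply => t0 /= t0ab.
exact: nP.
Qed.

Lemma cvg_itv_uniform (I : Type) (F : set_system I) (g : R -> I -> R) (g0 : R -> R)
    (a b k : R) : Filter F -> continuous g0 -> 0 < k ->
  (forall t0, t0 \in `[a, b] -> g p.1 p.2 @[p --> filter_prod (nbhs t0) F] --> g0 t0) ->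
  \forall i \near F, forall t, t \in `[a, b] -> `|g t i - g0 t| < k.
Proof.
move=> FF cg0 k0 cg; apply: near_itv_uniform => t0 t0ab.
have c0 : g0 p.1 @[p --> filter_prod (nbhs t0) F] --> g0 t0.
  by apply: (cvg_comp fst g0); [exact: cvg_fst|exact: cg0].
have : `|g p.1 p.2 - g0 p.1| @[p --> filter_prod (nbhs t0) F] --> `|g0 t0 - g0 t0|.
  by apply: cvg_norm; apply: cvgB => //; exact: cg.
by rewrite subrr normr0 => /cvgr_lt; apply.
Qed.

Lemma continuous_itv_bound (g : R -> R) (a b : R) : a <= b ->
  {within `[a, b], continuous g} ->
  exists2 K, 0 < K & forall t, t \in `[a, b] -> `|g t| <= K.
Proof.
move=> ab cg.
have cn : {within `[a, b], continuous (fun t => `|g t|)}.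
  by move=> t; apply: cvg_norm; exact: cg.
have [c _ cmax] := EVT_max ab cn.
exists (`|g c| + 1) => [|t /cmax tc]; first by rewrite ltr_wpDl.
by rewrite (le_trans tc)// lerDl.
Qed.

End uniformity.

Section persistence.
Variable R : realType.
Variables A B C D : mpoly.mpoly 2 R.
Variables dA dB : R -> R -> R -> R -> R.
Hypothesis dAP : radial_quotient A dA.
Hypothesis dBP : radial_quotient B dB.
Variables (r0 : R -> R) (r : R -> R -> R) (e0 : R).
Hypothesis star0 : starlike_periodic_orbit (xfield A C 0) (yfield B D 0) r0.
Hypothesis star : forall e, 0 < e < e0 ->
  starlike_periodic_orbit (xfield A C e) (yfield B D e) (r ^~ e).
Hypothesis e0_gt0 : 0 < e0.
Hypothesis den_neq0 : forall t, den0 A B (cos t) (sin t) (r0 t) != 0.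
Hypothesis cvg_r0 : r 0 e @[e --> 0^'+] --> r0 0.

Let SQ := slope_quotient A B dA dB.
Let S1 := slope1 A B C D.
Let den e v u s := den0 A B v u s + e * den1 C D v u s.

Lemma unperturbed_orbit_continuous : continuous r0.
Proof.
move=> t; apply/differentiable_continuous/derivable1_diffP.
by case: star0 => sm _ _ _ _; exact: (sm 0).
Qed.

Lemma orbit_slope_quotient_continuous : continuous (fun t => SQ (cos t) (sin t) (r0 t) (r0 t)).
Proof.
move=> t; have cr := @unperturbed_orbit_continuous t.
by apply: cvg_slope_quotient => //; do ?[exact: continuous_cos|exact: continuous_sin].
Qed.

Lemma orbit_slope1_continuous : continuous (fun t => S1 (cos t) (sin t) (r0 t) 0).
Proof.
move=> t; have cr := @unperturbed_orbit_continuous t.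
apply: cvg_slope1 => //; do ?[exact: continuous_cos|exact: continuous_sin|exact: cvg_cst].
by rewrite mul0r addr0.
Qed.

(** The expansion of the slope bounds the derivative of the difference
    by [K * (`|r t e - r0 t| + e)] in a tube around the unperturbed orbit, where by
    compactness the denominators do not vanish and one constant [K] bounds both
    coefficients. Gronwall's inequality then keeps the perturbed orbit in the
    tube for a whole turn, and periodicity for all angles. *)
Lemma uniform_persistence eta : 0 < eta ->
  \forall e \near 0^'+, forall t, `|r t e - r0 t| < eta.
Proof.
move=> eta0.
(* the deviation from the unperturbed orbit, and the parameter *)
pose F := filter_prod (nbhs (0 : R)) (0 : R)^'+.
have FF : Filter F by apply: filter_prod_filter.
have pi2 : 0 <= pi *+ 2 :> R by rewrite pmulrn_lge0 ?pi_ge0.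
have [K1 K10 SQK] := continuous_itv_bound pi2 (continuous_subspaceT orbit_slope_quotient_continuous).
have [K2 K20 S1K] := continuous_itv_bound pi2 (continuous_subspaceT orbit_slope1_continuous).
have joint t0 (G := filter_prod (nbhs t0) F) :
  [/\ cos p.1 @[p --> G] --> cos t0, sin p.1 @[p --> G] --> sin t0,
    r0 p.1 @[p --> G] --> r0 t0, r0 p.1 + p.2.1 @[p --> G] --> r0 t0 &
    p.2.2 @[p --> G] --> (0 : R)].
  have c1 : fst @ G --> t0 by exact: cvg_fst.
  have cr : r0 p.1 @[p --> G] --> r0 t0.
    by apply: (cvg_comp fst r0); [exact: c1|exact: unperturbed_orbit_continuous].
  have c2 : snd @ G --> F by exact: cvg_snd.
  split=> //.
  - by apply: (cvg_comp fst (@cos R)); [exact: c1|exact: continuous_cos].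
  - by apply: (cvg_comp fst (@sin R)); [exact: c1|exact: continuous_sin].
  - rewrite -[X in _ --> X]addr0; apply: cvgD => //.
    by apply: (cvg_comp snd fst); [exact: c2|exact: cvg_fst].
  - apply: (cvg_comp snd snd); first exact: c2.
    apply: cvg_trans; first exact: cvg_snd.
    exact: cvg_within.
have n1 : \forall i \near F, forall t, t \in `[0, pi *+ 2] ->
    den0 A B (cos t) (sin t) (r0 t + i.1) != 0 /\
    den i.2 (cos t) (sin t) (r0 t + i.1) != 0.
  apply: near_itv_uniform => t0 _; have [cc cs cr cz ce] := joint t0.
  near=> p; split; near: p.
    by apply: (cvgr_neq0 _ (cvg_den0 _ cc cs cz)).
  apply: (cvgr_neq0 _ (cvg_den _ cc cs cz ce)).
  by rewrite mul0r addr0.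
have n2 : \forall i \near F, forall t, t \in `[0, pi *+ 2] ->
    `|SQ (cos t) (sin t) (r0 t + i.1) (r0 t) - SQ (cos t) (sin t) (r0 t) (r0 t)| < 1.
  apply: cvg_itv_uniform => //; first exact: orbit_slope_quotient_continuous.
  move=> t0 _; have [cc cs cr cz ce] := joint t0.
  exact: cvg_slope_quotient.
have n3 : \forall i \near F, forall t, t \in `[0, pi *+ 2] ->
    `|S1 (cos t) (sin t) (r0 t + i.1) i.2 - S1 (cos t) (sin t) (r0 t) 0| < 1.
  apply: cvg_itv_uniform => //; first exact: orbit_slope1_continuous.
  move=> t0 _; have [cc cs cr cz ce] := joint t0.
  by apply: cvg_slope1 => //; rewrite mul0r addr0.
have [[U V] /= [/nbhs_ballP[z /= z0 zU] V0] UV] := filterI n1 (filterI n2 n3).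
pose K := K1 + K2 + 1.
have K0 : 0 < K by rewrite !addr_gt0.
pose eta' := Num.min eta z.
have eta'0 : 0 < eta' by rewrite lt_min eta0.
have small : \forall e \near (0 : R)^'+,
    ((r 0 e - r0 0) ^+ 2 + e ^+ 2) * expR (3 * K * (pi *+ 2 - 0)) < eta' ^+ 2.
  have : ((r 0 e - r0 0) ^+ 2 + e ^+ 2) * expR (3 * K * (pi *+ 2 - 0)) @[e --> (0:R)^'+]
     --> ((r0 0 - r0 0) ^+ 2 + 0 ^+ 2) * expR (3 * K * (pi *+ 2 - 0)).
    apply: cvgM; last exact: cvg_cst.
    apply: cvgD; last by apply: cvg_sqr; exact: cvg_within.
    by apply: cvg_sqr; apply: cvgB => //; exact: cvg_cst.
  rewrite subrr !expr0n/= addr0 mul0r => /cvgr_lt; apply.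
  by rewrite exprn_gt0.
near=> e => t.
have e_gt0 : 0 < e by near: e; exact: nbhs_right_gt.
have e_lt : 0 < e < e0.
  by rewrite e_gt0/=; near: e; exact: nbhs_right_lt.
have Ve : V e by near: e.
have se := star e_lt.
have [t' t'I redE] := angle_reduction t.
have [_ per0 _ _ _] := star0; have [_ per _ _ _] := se.
rewrite (redE r0 per0) (redE (r ^~ e) per).
apply: (@lt_le_trans _ _ eta'); last by rewrite ge_min lexx.
move: t' t'I {redE}.
pose d' s := derive1 (r ^~ e) s - derive1 r0 s.
have good s : s \in `[0, pi *+ 2] -> `|r s e - r0 s| < eta' ->
  [/\ den0 A B (cos s) (sin s) (r s e) != 0, den e (cos s) (sin s) (r s e) != 0,
   `|SQ (cos s) (sin s) (r s e) (r0 s)| <= K & `|S1 (cos s) (sin s) (r s e) e| <= K].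
  move=> sI rs.
  have Us : U (r s e - r0 s).
    apply: zU; rewrite /ball/= sub0r normrN (lt_le_trans rs)// ge_min lexx orbT//.
  have [h1 [h2 h3]] := UV (r s e - r0 s, e) (conj Us Ve).
  have := h1 s sI; have := h2 s sI; have := h3 s sI.
  have -> : r0 s + (r s e - r0 s) = r s e by rewrite addrC subrK.
  rewrite /= => k3 k2 [k1 k1']; split=> //.
    have := ler_normD (SQ (cos s) (sin s) (r s e) (r0 s) - SQ (cos s) (sin s) (r0 s) (r0 s))
      (SQ (cos s) (sin s) (r0 s) (r0 s)); rewrite subrK => /le_trans; apply.
    have := SQK s sI; rewrite /K; lra.
  have := ler_normD (S1 (cos s) (sin s) (r s e) e - S1 (cos s) (sin s) (r0 s) 0)
    (S1 (cos s) (sin s) (r0 s) 0); rewrite subrK => /le_trans; apply.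
  have := S1K s sI; rewrite /K; lra.
apply: (@gronwall_bound _ _ d' _ _ K e) => //; try exact: ltW.
- move=> s _; apply: is_deriveB; first exact: (starlike_polar_ode s se).1.
  exact: (starlike_polar_ode s star0).1.
- move=> s sI rs; have [g1 g2 g3 g4] := good s sI rs.
  have E1 := @derive_val _ _ _ _ _ _ _ (starlike_slope se g2).
  have g0 : den0 A B (cos s) (sin s) (r0 s) + 0 * den1 C D (cos s) (sin s) (r0 s) != 0.
    by rewrite mul0r addr0.
  have E2 := @derive_val _ _ _ _ _ _ _ (starlike_slope star0 g0).
  have -> : d' s = SQ (cos s) (sin s) (r s e) (r0 s) * (r s e - r0 s)
      + e * S1 (cos s) (sin s) (r s e) e.
    rewrite /d' !derive1E E1 E2 (slope_expansion dAP dBP g1 (den_neq0 s) g2).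
    by rewrite /slope !mul0r !addr0 -/SQ -/S1; ring.
  move: g3 g4; move: (SQ _ _ _ _) (S1 _ _ _ _) => P Q hP hQ.
  rewrite (le_trans (ler_normD _ _))// !normrM (gtr0_norm e_gt0) mulrDr.
  by apply: lerD; [|rewrite [e * _]mulrC]; rewrite ler_wpM2r// ltW.
- by near: e.
Unshelve. all: by end_near. Qed.

Lemma cvg_persistence (phi : R -> R) t0 : {for t0, continuous phi} ->
  r (phi p.1) p.2 @[p --> filter_prod (nbhs t0) (0:R)^'+] --> r0 (phi t0).
Proof.
move=> cphi; set G := filter_prod _ _.
have cf : r0 (phi p.1) @[p --> G] --> r0 (phi t0).
  apply: (cvg_comp fst (r0 \o phi)); first exact: cvg_fst.
  by apply: (cvg_comp phi r0); [exact: cphi|exact: unperturbed_orbit_continuous].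
apply/cvgrPdist_lt => k k0.
have k2 : 0 < k / 2 by rewrite divr_gt0.
have up : \forall p \near G, forall t, `|r t p.2 - r0 t| < k / 2.
  exact: (@cvg_snd _ _ (nbhs t0) (0:R)^'+ _ _ (uniform_persistence k2)).
have cp : \forall p \near G, `|r0 (phi t0) - r0 (phi p.1)| < k / 2.
  by move/cvgrPdist_lt : cf; apply.
near=> p.
rewrite [ltRHS](splitr k).
rewrite (_ : _ - _ = (r0 (phi t0) - r0 (phi p.1)) - (r (phi p.1) p.2 - r0 (phi p.1))); last by ring.
rewrite (le_lt_trans (ler_normB _ _))// ltrD//; first by near: p.
by have : forall t, `|r t p.2 - r0 t| < k / 2 by near: p.
Unshelve. all: by end_near. Qed.

Hypothesis r0_sym : forall t, r0 (pi - t) = r0 t.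

Let Lam t := SQ (cos t) (sin t) (r0 t) (r0 t).
Let m0 t := S1 (cos t) (sin t) (r0 t) 0 + S1 (- cos t) (sin t) (r0 t) 0.

Lemma orbit_slope1_sum_continuous : continuous m0.
Proof.
move=> t; have cr := @unperturbed_orbit_continuous t.
apply: cvgD; first exact: orbit_slope1_continuous.
apply: cvg_slope1 => //; do ?[exact: continuous_sin|exact: cvg_cst].
- by apply: cvgN; exact: continuous_cos.
- by rewrite den0N.
- by rewrite mul0r addr0 den0N.
Qed.

(** The antisymmetric part [h t = (r t e - r (pi - t) e) / e] vanishes at both
    endpoints, which the reflection fixes, the first one up to a full turn. By
    reversibility it satisfies a linear equation
    [h' = Le * h + me] whose coefficients tend uniformly to [Lam] and [m0], hence
    it is bounded, and the derivative of [h * E] is uniformly close to that of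
    [J]. So [J] has the same increment as [h * E] up to an arbitrarily small
    error, and that increment is zero. *)
Lemma first_order_condition (E J : R -> R) :
  (forall t, t \in `[- (pi / 2), pi / 2] -> is_derive t 1 E (- Lam t * E t)) ->
  (forall t, t \in `[- (pi / 2), pi / 2] -> is_derive t 1 J (E t * m0 t)) ->
  J (pi / 2) = J (- (pi / 2)).
Proof.
move=> dE dJ.
set a : R := - (pi / 2); set b : R := pi / 2.
have b0 : 0 < b by rewrite divr_gt0 ?pi_gt0.
have ab : a <= b by rewrite /a -/b; lra.
have cE : {within `[a, b], continuous E}.
  by apply: derivable_within_continuous => t /dE [].
have [KE KE0 EK] := continuous_itv_bound ab cE.
have [K1 K10 LK] := continuous_itv_bound ab (continuous_subspaceT orbit_slope_quotient_continuous).
have [K2 K20 mK] := continuous_itv_bound ab (continuous_subspaceT orbit_slope1_sum_continuous).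
pose K := K1 + K2 + 2.
have K0 : 0 < K by rewrite !addr_gt0.
pose H := expR (3 * K * (b - a)) + 1.
have H0 : 0 < H by rewrite addr_gt0 ?expR_gt0.
pose M := KE * (H + 1) * (b - a).
have ba0 : 0 < b - a by rewrite /a -/b; lra.
have M0 : 0 < M by rewrite !mulr_gt0// addr_gt0.
suff key k : 0 < k -> k <= 1 -> `|J b - J a| <= M * k.
  apply/eqP; rewrite -subr_eq0 -normr_le0 leNgt; apply/negP => X0.
  pose k := Num.min 1 (`|J b - J a| / (2 * M)).
  have k0 : 0 < k by rewrite lt_min ltr01 divr_gt0// mulr_gt0.
  have k1 : k <= 1 by rewrite ge_min lexx.
  have := key k k0 k1; apply/negP; rewrite -ltNge.
  apply: (@le_lt_trans _ _ (M * (`|J b - J a| / (2 * M)))).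
    by rewrite ler_pM2l// ge_min lexx orbT.
  rewrite (_ : M * _ = `|J b - J a| / 2); first lra.
  by field; rewrite gt_eqF.
move=> k0 k1.
have joint t0 (G := filter_prod (nbhs t0) (0:R)^'+) :
  [/\ cos p.1 @[p --> G] --> cos t0, sin p.1 @[p --> G] --> sin t0,
    r p.1 p.2 @[p --> G] --> r0 t0, r (pi - p.1) p.2 @[p --> G] --> r0 t0 &
    p.2 @[p --> G] --> (0 : R)].
  have c1 : fst @ G --> t0 by exact: cvg_fst.
  split.
  - by apply: (cvg_comp fst (@cos R)); [exact: c1|exact: continuous_cos].
  - by apply: (cvg_comp fst (@sin R)); [exact: c1|exact: continuous_sin].
  - by apply: (@cvg_persistence id).
  - rewrite -[in X in _ --> X]r0_sym; apply: (@cvg_persistence (fun t => pi - t)).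
    by apply: cvgB; [exact: cvg_cst|].
  - apply: cvg_trans; first exact: cvg_snd.
    exact: cvg_within.
have n1 : \forall e \near (0:R)^'+, forall t, t \in `[a, b] ->
    (den0 A B (cos t) (sin t) (r t e) != 0 /\
     den e (cos t) (sin t) (r t e) != 0) /\
    (den0 A B (cos t) (sin t) (r (pi - t) e) != 0 /\
     den e (- cos t) (sin t) (r (pi - t) e) != 0).
  apply: near_itv_uniform => t0 _; have [cc cs cr cz ce] := joint t0.
  have cN : - cos p.1 @[p --> filter_prod (nbhs t0) (0:R)^'+] --> - cos t0 by exact: cvgN.
  have dt0 := den_neq0 t0.
  near=> p; split; split; near: p.
  - exact: (cvgr_neq0 _ (cvg_den0 _ cc cs cr)).
  - by apply: (cvgr_neq0 _ (cvg_den _ cc cs cr ce)); rewrite mul0r addr0.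
  - exact: (cvgr_neq0 _ (cvg_den0 _ cc cs cz)).
  - by apply: (cvgr_neq0 _ (cvg_den _ cN cs cz ce)); rewrite mul0r addr0 den0N.
have n2 : \forall e \near (0:R)^'+, forall t, t \in `[a, b] ->
    `|SQ (cos t) (sin t) (r t e) (r (pi - t) e) - Lam t| < k.
  apply: cvg_itv_uniform => //; first exact: orbit_slope_quotient_continuous.
  move=> t0 _; have [cc cs cr cz ce] := joint t0.
  exact: cvg_slope_quotient.
have n3 : \forall e \near (0:R)^'+, forall t, t \in `[a, b] ->
    `|(S1 (cos t) (sin t) (r t e) e + S1 (- cos t) (sin t) (r (pi - t) e) e) - m0 t| < k.
  apply: cvg_itv_uniform => //; first exact: orbit_slope1_sum_continuous.
  move=> t0 _; have [cc cs cr cz ce] := joint t0.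
  have cN : - cos p.1 @[p --> filter_prod (nbhs t0) (0:R)^'+] --> - cos t0 by exact: cvgN.
  apply: cvgD; apply: cvg_slope1 => //; rewrite ?mul0r ?addr0 ?den0N//.
have /filter_ex[e [e_gt0 e_lt d1 d2 d3]] : \forall e \near (0:R)^'+, [/\ 0 < e, e < e0,
    forall t, t \in `[a, b] ->
    (den0 A B (cos t) (sin t) (r t e) != 0 /\
     den e (cos t) (sin t) (r t e) != 0) /\
    (den0 A B (cos t) (sin t) (r (pi - t) e) != 0 /\
     den e (- cos t) (sin t) (r (pi - t) e) != 0),
    forall t, t \in `[a, b] ->
      `|SQ (cos t) (sin t) (r t e) (r (pi - t) e) - Lam t| < k &
    forall t, t \in `[a, b] ->
    `|(S1 (cos t) (sin t) (r t e) e + S1 (- cos t) (sin t) (r (pi - t) e) e) - m0 t| < k].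
  near=> e; split; near: e => //; first exact: nbhs_right_gt.
  exact: nbhs_right_lt.
have se : starlike_periodic_orbit (xfield A C e) (yfield B D e) (r ^~ e).
  by apply: star; rewrite e_gt0.
pose h t := (r t e - r (pi - t) e) / e.
pose Le t := SQ (cos t) (sin t) (r t e) (r (pi - t) e).
pose me t := S1 (cos t) (sin t) (r t e) e + S1 (- cos t) (sin t) (r (pi - t) e) e.
have dh t : t \in `[a, b] -> is_derive t 1 h (Le t * h t + me t).
  move=> /d1[[g1 g2] [g3 g4]].
  have D1 := starlike_slope se g2.
  have g5 : den0 A B (cos (pi - t)) (sin (pi - t)) (r (pi - t) e)
      + e * den1 C D (cos (pi - t)) (sin (pi - t)) (r (pi - t) e) != 0.
    by rewrite cos_piB sin_piB.
  have D2 := starlike_slope se g5.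
  have D3 : is_derive t 1 (fun t : R => pi - t) (-1).
    by apply: is_derive_eq; rewrite add0r mul1r.
  have D4 := @is_derive1_comp _ (r ^~ e) (fun t : R => pi - t) t _ _ D2 D3.
  have g1' : den0 A B (- cos t) (sin t) (r (pi - t) e) != 0 by rewrite den0N.
  have E1 := slope_expansion dAP dBP g1 g3 g2.
  have E2 := slope_expansion dAP dBP g1' g1' g4.
  rewrite cos_piB sin_piB E2 num0N den0N in D4; rewrite E1 in D1.
  rewrite /h; apply: is_derive_eq.
  rewrite /Le /me /h -/SQ -/S1 /GRing.scale/=.
  rewrite mulNr; move: (SQ (cos t) _ _ _) (SQ (- cos t) _ _ _) (S1 (cos t) _ _ _) (S1 (- cos t) _ _ _).
  move: (_ / den0 _ _ _ _ _) => x0 x1 x2 x3 x4.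
  by field; rewrite gt_eqF.
have ha : h a = 0.
  have [_ per _ _ _] := se.
  rewrite /h (_ : pi - a = a + pi *+ 2); last by rewrite /a /b; lra.
  by rewrite per subrr mul0r.
have hb : h b = 0.
  by rewrite /h (_ : pi - b = b) ?subrr ?mul0r// /b; lra.
have hH t : t \in `[a, b] -> `|h t| < H.
  apply: (@gronwall_bound _ h (fun t => Le t * h t + me t) a b K 1) => //.
  - exact: ltW.
  - move=> s sI _.
    have l1 : `|Le s| <= K1 + 1.
      have := ler_normD (Le s - Lam s) (Lam s); rewrite subrK => /le_trans; apply.
      by rewrite addrC lerD ?LK// (le_trans (ltW (d2 s sI))).
    have l2 : `|me s| <= K2 + 1.
      have := ler_normD (me s - m0 s) (m0 s); rewrite subrK => /le_trans; apply.
      by rewrite addrC lerD ?mK// (le_trans (ltW (d3 s sI))).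
    rewrite (le_trans (ler_normD _ _))// normrM mulrDr mulr1 lerD//.
      by rewrite ler_wpM2r// (le_trans l1)// /K; lra.
    by rewrite (le_trans l2)// /K; lra.
  - rewrite ha expr0n/= add0r expr1n mul1r /H sqrrD expr1n mulr1.
    have := expR_gt0 (3 * K * (b - a)); move: (expR _) => x x0.
    have := sqr_ge0 x; lra.
pose W t := h t * E t - J t.
have dW t : t \in `[a, b] ->
    is_derive t 1 W (E t * ((Le t - Lam t) * h t + (me t - m0 t))).
  move=> tI; have ? := dh t tI; have ? := dE t tI; have ? := dJ t tI.
  rewrite /W; apply: is_derive_eq.
  by rewrite /GRing.scale/=; ring.
have [|c cI WE] := @MVT_segment _ W _ a b ab (fun t tI => dW t (subset_itv_oo_cc tI)).
  by apply: derivable_within_continuous => t tI; case: (dW t tI).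
have -> : `|J b - J a| = `|W b - W a|.
  by rewrite /W ha hb !mul0r !sub0r -normrN; congr `|_|; ring.
rewrite WE normrM (gtr0_norm ba0) /M mulrAC ler_pM2r//.
rewrite normrM -mulrA ler_pM ?EK//.
rewrite [leRHS]mulrDl mul1r (le_trans (ler_normD _ _))// lerD//; last exact: ltW (d3 c cI).
by rewrite normrM mulrC ler_pM// ltW ?hH ?d2.
Unshelve. all: by end_near. Qed.

End persistence.

(** * Back to the variable [u] *)

Section arcsine.
Variable R : realType.
Notation mu := (@lebesgue_measure R).

Let pihalf_gt0 : 0 < pi / 2 :> R. Proof. by rewrite divr_gt0 ?pi_gt0. Qed.

Lemma asin_oo (u : R) : u \in `]-1, 1[ -> asin u \in `]- (pi / 2), (pi / 2)[.
Proof.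
rewrite !in_itv/= => /andP[u1 u2].
by rewrite asin_gtNpi2 ?u1 ?ltW//= asin_ltpi2// u2 ltW.
Qed.

Lemma cos_asin_gt0 (u : R) : u \in `]-1, 1[ -> 0 < cos (asin u).
Proof. by move=> /asin_oo; rewrite in_itv/=; exact: cos_gt0_pihalf. Qed.

Lemma is_derive_asin (u : R) : u \in `]-1, 1[ ->
  is_derive u 1 (@asin R) (cos (asin u))^-1.
Proof.
rewrite in_itv/= => /andP[u1 u2]; rewrite cos_asin ?ltW//.
by apply: is_derive1_asin; rewrite u1.
Qed.

Lemma asin_within_continuous : {within `[-1, 1], continuous (@asin R)}.
Proof.
rewrite -(sin_pihalf R) -sinN.
apply: segment_can_le_continuous; first by rewrite ge0_cp// ltW.
  by apply: continuous_subspaceT; exact: continuous_sin.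
exact: sinK.
Qed.

Lemma asin1 : asin 1 = pi / 2 :> R.
Proof.
rewrite -[X in asin X](sin_pihalf R); apply: sinK.
by rewrite in_itv/= lexx andbT ge0_cp// ltW.
Qed.

Lemma asinN1 : asin (-1) = - (pi / 2) :> R.
Proof.
rewrite -[X in asin (- X)](sin_pihalf R) -sinN; apply: sinK.
by rewrite in_itv/= lexx ge0_cp// ltW.
Qed.

(** The change of variables [u = sin t]. The integrand has inverse square root
    singularities at both endpoints; it is dominated by a multiple of the
    derivative of the arcsine. *)
Lemma integral_arcsine_substitution (J j : R -> R) :
  (forall t, t \in `[- (pi / 2), pi / 2] -> {for t, continuous j}) ->
  (forall t, t \in `[- (pi / 2), pi / 2] -> is_derive t 1 J (j t)) ->
  (\int[mu]_(u in `](-1)%R, 1%R[) (j (asin u) / cos (asin u))%:E =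
    (J (pi / 2) - J (- (pi / 2)))%:E)%E.
Proof.
move=> cj dJ.
have ab : - (pi / 2) <= pi / 2 :> R by rewrite ge0_cp// ltW.
have cJ : {within `[- (pi / 2), pi / 2], continuous j}.
  by apply: continuous_in_subspaceT => t /set_mem/=; exact: cj.
have [K K0 jK] := continuous_itv_bound ab cJ.
have casin (u : R) : u \in `]-1, 1[ -> {for u, continuous (@asin R)}.
  by move=> /is_derive_asin[+ _] => d; apply/differentiable_continuous/derivable1_diffP.
have ccos (u : R) : u \in `]-1, 1[ -> (cos (asin x))^-1 @[x --> u] --> (cos (asin u))^-1.
  move=> uI; apply: cvgV; first by rewrite gt_eqF ?cos_asin_gt0.
  by apply: (cvg_comp (@asin R) (@cos R)); [exact: casin|exact: continuous_cos].
have sub (u : R) : u \in `]-1, 1[ -> asin u \in `[- (pi / 2), pi / 2].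
  by move=> /asin_oo; exact: subset_itv_oo_cc.
have lt11 : -1 < 1 :> R by rewrite gt0_cp.
have [_ al ar] := (continuous_within_itvP _ lt11).1 asin_within_continuous.
rewrite asinN1 in al; rewrite asin1 in ar.
have cJt t : t \in `[- (pi / 2), pi / 2] -> {for t, continuous J}.
  by move=> /dJ[d _]; apply/differentiable_continuous/derivable1_diffP.
have dJ_asin (u : R) : u \in `]-1, 1[ ->
    is_derive u 1 (fun x => J (asin x)) (j (asin u) / cos (asin u)).
  by move=> uI; apply: is_derive1_comp; [exact/dJ/sub|exact: is_derive_asin].
have dK_asin (u : R) : u \in `]-1, 1[ ->
    is_derive u 1 (fun x => K * asin x) (K / cos (asin u)).
  move=> uI; have ? := is_derive_asin uI.
  by apply: is_derive_eq; rewrite /GRing.scale/=; ring.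
apply: (dominated_itv_oo_FTC2 lt11 _ _ _ dJ_asin dK_asin).
- move=> u uI; rewrite normrM normfV (gtr0_norm (cos_asin_gt0 uI)).
  by rewrite ler_pM2r ?invr_gt0 ?cos_asin_gt0// jK// sub.
- move=> u uI; apply: cvgM; last exact: ccos.
  by apply: (cvg_comp (@asin R) j); [exact: casin|apply: cj; exact: sub].
- by move=> u uI; apply: cvgM; [exact: cvg_cst|exact: ccos].
- apply: (cvg_comp (@asin R) J); first exact: al.
  by apply: cJt; rewrite in_itv/= lexx.
- apply: (cvg_comp (@asin R) J); first exact: ar.
  by apply: cJt; rewrite in_itv/= lexx andbT.
- by apply: cvgM; [exact: cvg_cst|exact: al].
- by apply: cvgM; [exact: cvg_cst|exact: ar].
Qed.

Lemma derive0_itv_constant (W : R -> R) (a b x y : R) :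
  (forall t, t \in `]a, b[ -> is_derive t 1 W 0) ->
  x \in `]a, b[ -> y \in `]a, b[ -> W x = W y.
Proof.
move=> dW; wlog xy : x y / x <= y.
  move=> wl xI yI; have [/wl|/ltW/wl] := leP x y; first exact.
  by move=> /(_ yI xI).
rewrite !in_itv/= => /andP[ax _] /andP[_ yb].
have sub t : t \in `[x, y] -> t \in `]a, b[.
  by rewrite !in_itv/= => /andP[xt ty]; rewrite (lt_le_trans ax)//= (le_lt_trans ty).
have dW_xy t : t \in `]x, y[ -> is_derive t 1 W 0.
  by move=> /subset_itv_oo_cc/sub; exact: dW.
have [|c _ /eqP] := MVT_segment xy dW_xy.
  by apply: derivable_within_continuous => t /sub/dW[].
by rewrite mul0r subr_eq0 => /eqP.
Qed.

End arcsine.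

Section melnikov_polar.
Variable R : realType.
Variables A B C D : mpoly.mpoly 2 R.
Variables A01 A10 B01 B10 C0 C1 D0 D1 : mpoly.mpoly 3 R.
Hypothesis hA : even_poly_decomposition A A01 A10.
Hypothesis hB : even_poly_decomposition B B01 B10.
Hypothesis hC : poly_decomposition C C0 C1.
Hypothesis hD : poly_decomposition D D0 D1.
Variables dA dB : R -> R -> R -> R -> R.
Hypothesis dAP : radial_quotient A dA.
Hypothesis dBP : radial_quotient B dB.

Lemma radial_eval00 (K : mpoly.mpoly 2 R) v u r : v ^+ 2 = 1 - u ^+ 2 ->
  radial K v u r = eval00 K r u.
Proof. by move=> vu; rewrite /radial /eval00 exprMn vu mulrC [r * u]mulrC. Qed.

Lemma den0E v u r : v ^+ 2 = 1 - u ^+ 2 ->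
  den0 A B v u r = (1 - u ^+ 2) * eval00 B r u * r - u * eval00 A r u.
Proof. by move=> vu; rewrite /den0 !radial_eval00// vu. Qed.

(** The radial derivative of the unperturbed slope. The additional term
    [- u / v] is the logarithmic derivative of the cosine: it accounts for
    the passage from the difference [r t e - r (pi - t) e = 2 * v * g] to the
    function [g] of the decomposition. *)
Lemma melnikov_LE (f : R -> R) v u : v ^+ 2 = 1 - u ^+ 2 -> v != 0 ->
  den0 A B v u (f u) != 0 ->
  slope_quotient A B dA dB v u (f u) (f u) =
  v * melnikov_L A B A10 B10 f u - u / v.
Proof.
move=> vu v0; rewrite /slope_quotient /melnikov_L /melnikov_S /num0 den0E//.
rewrite (radial_quotient_diag _ hA dAP)// (radial_quotient_diag _ hB dBP)//.
rewrite !radial_eval00// -vu.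
have one : u ^+ 2 + v ^+ 2 = 1 by rewrite vu addrC subrK.
move: (f u) (eval00 A _ _) (eval00 B _ _) (eval3 A10 _ _ _) (eval3 B10 _ _ _).
move=> z a b a10 b10.
set q := v ^+ 2 * b * z - u * a; set n := (X in X / (q * q)) => q0.
have -> : u * a - v ^+ 2 * b * z = - q by rewrite opprB.
set S := (X in X / (v ^+ 2 * _)).
(* the two sides agree modulo [u ^+ 2 + v ^+ 2 = 1] *)
have -> : S = v * n + u * q ^+ 2.
  transitivity (v ^+ 2 * ((u ^+ 2 + v ^+ 2) * (a10 * b - a * b10)
      + 2 * u * v ^+ 2 * b ^+ 2) * z ^+ 2
    - 4 * u ^+ 2 * v ^+ 2 * a * b * z
    - u * (u ^+ 2 + v ^+ 2 - 2 * u ^+ 2) * a ^+ 2).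
    by rewrite one mul1r.
  by rewrite /n /q; ring.
by rewrite sqrrN; field; rewrite v0 q0.
Qed.

(** Summing over [v] and [- v] selects the even part [D0] of [D] and the odd
    part [C1] of [C]. *)
Lemma melnikov_ME (f : R -> R) v u : v ^+ 2 = 1 - u ^+ 2 -> v != 0 ->
  den0 A B v u (f u) != 0 ->
  slope1 A B C D v u (f u) 0 + slope1 A B C D (- v) u (f u) 0 =
  2 * v ^+ 2 * melnikov_M A B C1 D0 f u.
Proof.
move=> vu v0 d0.
have split0 (H : mpoly.mpoly 2 R) (H0 H1 : mpoly.mpoly 3 R) w :
    poly_decomposition H H0 H1 -> w ^+ 2 = 1 - u ^+ 2 ->
    eval2 H (f u * w) (f u * u) = eval3 H0 (f u) 0 u + w * eval3 H1 (f u) 0 u.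
  by move=> hH wu; have := hH (f u) 0 u w wu; rewrite mulr0 addr0.
have Nvu : (- v) ^+ 2 = 1 - u ^+ 2 by rewrite sqrrN.
rewrite /slope1 !mul0r !addr0 num0N den0N /num1 /den1 /num0.
rewrite !(split0 _ _ _ _ hC)// !(split0 _ _ _ _ hD)// /melnikov_M.
move: d0; rewrite den0E// !radial_eval00// -vu.
move: (f u) (eval00 A _ _) (eval00 B _ _) (eval3 C0 _ _ _) (eval3 C1 _ _ _).
move=> z a b c d; move: (eval3 D0 _ _ _) (eval3 D1 _ _ _) => q p d0.
have one : u ^+ 2 + v ^+ 2 = 1 by rewrite vu addrC subrK.
have -> : u * a - v ^+ 2 * b * z = - (v ^+ 2 * b * z - u * a) by rewrite opprB.
move: d0; set w := v ^+ 2 * b * z - u * a => d0; rewrite -mulrDl.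
set n := (X in X / (w * w)).
have -> : n = - (2 * z * (a * q - v ^+ 2 * b * d * z)).
  transitivity (- (2 * z * ((u ^+ 2 + v ^+ 2) * (a * q - v ^+ 2 * b * d * z)))).
    by rewrite /n /w; ring.
  by rewrite one mul1r.
by rewrite sqrrN; field; rewrite v0 d0.
Qed.

End melnikov_polar.

Unset Implicit Arguments.

(** * The theorem *)

Theorem theorem1p3 (R : realType) (A B C D : mpoly.mpoly 2 R)
  (A01 A10 B01 B10 C0 C1 D0 D1 : mpoly.mpoly 3 R)
  (hC00 : eval2 C 0 0 = 0) (hD00 : eval2 D 0 0 = 0)
  (hU : \forall p \near ((0, 0) : R * R)^',
     p.1 ^+ 2 * eval2 B (p.1 ^+ 2) p.2 - p.2 * eval2 A (p.1 ^+ 2) p.2 != 0)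
  (hA : even_poly_decomposition A A01 A10)
  (hB : even_poly_decomposition B B01 B10)
  (hC : poly_decomposition C C0 C1)
  (hD : poly_decomposition D D0 D1)
  (rho0 : R) (hrho0 : 0 < rho0)
  (f : R -> R) (hf : cauchy_solution A B rho0 f)
  (horbit : starlike_periodic_orbit (xfield A C 0) (yfield B D 0)
     (fun theta => f (sin theta)))
  (hfamily : exists (e0 : R) (r : R -> R -> R),
     [/\ 0 < e0,
         (forall theta e, 0 < e < e0 ->
            {for (theta, e), continuous (fun p : R * R => r p.1 p.2)}),
         (forall e, 0 < e < e0 ->
            starlike_periodic_orbit (xfield A C e) (yfield B D e)
              (fun theta => r theta e) /\
            limit_cycle (xfield A C e) (yfield B D e)
              (polar_curve (fun theta => r theta e))) &
         r 0 e @[e --> 0^'+] --> rho0]) :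
  melnikov A B A10 B10 C1 D0 f = 0%E.

Proof.
have [fc f0 fden _] := hf.
have [e0 [r [e0_gt0 _ star cvg_r]]] := hfamily.
have [dA dAP] := radial_quotient_exists A.
have [dB dBP] := radial_quotient_exists B.
pose r0 (t : R) := f (sin t).
have cs2 t : cos t ^+ 2 = 1 - sin t ^+ 2 :> R by exact: cos2sin2.
have den_neq0 t : den0 A B (cos t) (sin t) (r0 t) != 0.
  by rewrite den0E// fden// sin_geN1 sin_le1.
have star' e : 0 < e < e0 ->
    starlike_periodic_orbit (xfield A C e) (yfield B D e) (r ^~ e).
  by move=> /star[].
have cvg_r0 : r 0 e @[e --> 0^'+] --> r0 0 by rewrite /r0 sin0 f0.
have r0_sym t : r0 (pi - t) = r0 t.
  by rewrite /r0 sin_piB.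
pose Lam t := slope_quotient A B dA dB (cos t) (sin t) (r0 t) (r0 t).
pose m t := slope1 A B C D (cos t) (sin t) (r0 t) 0
  + slope1 A B C D (- cos t) (sin t) (r0 t) 0.
have cLam : continuous Lam := orbit_slope_quotient_continuous dAP dBP horbit den_neq0.
have cm : continuous m := orbit_slope1_sum_continuous horbit den_neq0.
(* [Lam] and [m] are continuous on the whole line; the segment of integration,
   endpoints included, is inside the open interval of radius [2] because
   [pi / 2 < 2] *)
have I02 : (-2 : R) < (0 : R) < 2 by apply/andP; split; lra.
have sub2 (t : R) : t \in `[- (pi / 2), pi / 2] -> t \in `]-2, 2[.
  have := @pihalf_lt2 R; rewrite !in_itv/= => p2 /andP[t1 t2].
  by rewrite (le_lt_trans t2)// andbT (lt_le_trans _ t1)// ltrN2.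
pose P x := oriented_integral 0 x Lam.
have dP (t : R) : t \in `]-2, 2[ -> is_derive t 1 P (Lam t).
  by apply: oriented_integral_primitive => // s _; exact: cLam.
pose E t := expR (- P t).
have dE (t : R) : t \in `]-2, 2[ -> is_derive t 1 E (- Lam t * E t).
  move=> /dP dPt.
  have dNP : is_derive t 1 (fun x => - P x) (- Lam t) by exact: is_deriveN.
  have := @is_derive1_comp _ expR (fun x => - P x) t _ _ (is_derive_expR _) dNP.
  by rewrite mulrC.
have cE (t : R) : t \in `]-2, 2[ -> {for t, continuous E}.
  by move=> /dE[d _]; apply/differentiable_continuous/derivable1_diffP.
have cEm (t : R) : t \in `]-2, 2[ -> {for t, continuous (fun s => E s * m s)}.
  by move=> tI; apply: cvgM; [exact: cE|exact: cm].
pose J x := oriented_integral 0 x (fun s => E s * m s).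
have dJ (t : R) : t \in `]-2, 2[ -> is_derive t 1 J (E t * m t).
  by apply: oriented_integral_primitive.
have JE : J (pi / 2) = J (- (pi / 2)).
  exact: (first_order_condition dAP dBP horbit star' e0_gt0 den_neq0 cvg_r0 r0_sym
    (fun t tI => dE t (sub2 t tI)) (fun t tI => dJ t (sub2 t tI))).
have LE (u : R) : u \in `]-1, 1[ ->
    Lam (asin u) = cos (asin u) * melnikov_L A B A10 B10 f u - u / cos (asin u).
  move=> uI; have v0 : cos (asin u) != 0 by rewrite gt_eqF// cos_asin_gt0.
  have sK : sin (asin u) = u by apply: asinK; exact: subset_itv_oo_cc uI.
  have := den_neq0 (asin u); have := cs2 (asin u).
  rewrite /Lam /r0 sK => vu d0.
  exact: (melnikov_LE hA hB dAP dBP vu v0 d0).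
have ME (u : R) : u \in `]-1, 1[ ->
    m (asin u) = 2 * cos (asin u) ^+ 2 * melnikov_M A B C1 D0 f u.
  move=> uI; have v0 : cos (asin u) != 0 by rewrite gt_eqF// cos_asin_gt0.
  have sK : sin (asin u) = u by apply: asinK; exact: subset_itv_oo_cc uI.
  have := den_neq0 (asin u); have := cs2 (asin u).
  rewrite /m /r0 sK => vu d0.
  exact: (melnikov_ME hC hD vu v0 d0).
pose phi x := oriented_integral 0 x (melnikov_L A B A10 B10 f).
have cL : {in `]-1, 1[, continuous (melnikov_L A B A10 B10 f)}.
  move=> u uI.
  have dasin := is_derive_asin uI.
  have ca : {for u, continuous (@asin R)}.
    by case: dasin => d _; apply/differentiable_continuous/derivable1_diffP.
  have v0 : cos (asin u) != 0 by rewrite gt_eqF// cos_asin_gt0.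
  have ccos : cos (asin x) @[x --> u] --> cos (asin u).
    by apply: (cvg_comp (@asin R) (@cos R)); [exact: ca|exact: continuous_cos].
  have cV := cvgV v0 ccos.
  have LE' (x : R) : x \in `]-1, 1[ -> melnikov_L A B A10 B10 f x =
      (Lam (asin x) + x * (cos (asin x))^-1) * (cos (asin x))^-1.
    move=> xI; rewrite LE//.
    have x0 : cos (asin x) != 0 by rewrite gt_eqF// cos_asin_gt0.
    by field.
  rewrite /continuous_at LE'//.
  have near_eq : \forall x \near u, (Lam (asin x) + x * (cos (asin x))^-1)
      * (cos (asin x))^-1 = melnikov_L A B A10 B10 f x.
    near=> x; rewrite LE'//; near: x; exact: near_in_itvoo.
  apply: cvg_trans (near_eq_cvg near_eq) _.
  apply: cvgM; last exact: cV.
  apply: cvgD; last by apply: cvgM; [exact: cvg_id|exact: cV].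
  by apply: (cvg_comp (@asin R) Lam); [exact: ca|exact: cLam].
have I01 : (-1 : R) < (0 : R) < 1 by apply/andP; split; lra.
have dphi (u : R) : u \in `]-1, 1[ -> is_derive u 1 phi (melnikov_L A B A10 B10 f u).
  exact: oriented_integral_primitive.
(* the integrating factors in [u] and in the angle differ by a cosine, which
   comes from the term [- u / cos (asin u)] of [LE] *)
have EE (u : R) : u \in `]-1, 1[ -> expR (- phi u) = E (asin u) * cos (asin u).
  move=> uI.
  pose W x := phi x - P (asin x) + ln (cos (asin x)).
  have dW (x : R) : x \in `]-1, 1[ -> is_derive x 1 W 0.
    move=> xI; have da := is_derive_asin xI.
    have x0 := cos_asin_gt0 xI.
    have sK : sin (asin x) = x by apply: asinK; exact: subset_itv_oo_cc xI.
    have d1 := dphi x xI.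
    have dPx := dP _ (sub2 _ (subset_itv_oo_cc (asin_oo xI))).
    have d2 := @is_derive1_comp _ P (@asin R) x _ _ dPx da.
    have d3 := @is_derive1_comp _ (@cos R) (@asin R) x _ _ (is_derive_cos _) da.
    have d4 := @is_derive1_comp _ (@ln R) (@cos R \o @asin R) x _ _ (is_derive1_ln x0) d3.
    apply: is_derive_eq.
    have n0 : cos (asin x) != 0 by rewrite gt_eqF.
    by rewrite /= LE// sK; field.
  have I0 : (0 : R) \in `]-1, 1[ by rewrite in_itv/=.
  have := derive0_itv_constant dW uI I0.
  have asin0 : asin 0 = 0 :> R.
    rewrite -[X in asin X](sin0 R); apply: sinK.
    by rewrite in_itv/= oppr_le0 divr_ge0 ?pi_ge0.
  have oi0 h : oriented_integral 0 0 h = 0 :> R.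
    by rewrite /oriented_integral lexx set_itv1 Rintegral_set1.
  rewrite /W /phi /P asin0 !oi0 cos0 ln1 subrr addr0 -/(phi u) -/(P _) => W0.
  rewrite /E -[X in _ * X]lnK ?posrE ?cos_asin_gt0// -expRD; congr expR; lra.
rewrite /melnikov.
(* [M] is [m] over twice the squared cosine and the integrating factor contributes
   one cosine: the quotient is the derivative of the arcsine *)
transitivity (\int[lebesgue_measure]_(u in `](-1)%R, 1%R[)
    ((E (asin u) * m (asin u) / 2) / cos (asin u))%:E)%E.
  apply: eq_integral => u /set_mem/= uI.
  have n0 : cos (asin u) != 0 by rewrite gt_eqF// cos_asin_gt0.
  rewrite -/(phi u) EE// ME//; congr EFin; by field.
have dJ2 (t : R) : t \in `[- (pi / 2), pi / 2] ->
    is_derive t 1 (fun s => J s / 2) (E t * m t / 2).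
  move=> /sub2 tI; have ? := dJ t tI.
  by apply: is_derive_eq; rewrite /GRing.scale/=; ring.
rewrite (integral_arcsine_substitution _ dJ2); first by rewrite JE subrr.
by move=> t /sub2 tI; apply: cvgM; [exact: cEm|exact: cvg_cst].
Unshelve. all: by end_near. Qed.
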